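(* Let $n\ge 3$, $m\ge 1$ and let $g:\overline{\mathbb{B}^n}\to\mathbb{R}^m$ be continuous. If $f:\overline{\mathbb{B}^n}\to\mathbb{R}^m$ is continuous on $\overline{\mathbb{B}^n}$, of class $\mathcal{C}^2$ in $\mathbb{B}^n$, and satisfies $\Delta f=g$ in $\mathbb{B}^n$, then for all $x\in\overline{\mathbb{B}^n}$ $$\left|f(x)-\frac{1-|x|}{(1+|x|)^{n-1}}\,\mathcal{P}_f(0)\right|\le \|\mathcal{P}_f\|_\infty\left[1-\frac{1-|x|}{(1+|x|)^{n-1}}\right]+\frac{\|g\|_\infty}{2n}(1-|x|^2).$$ Moreover, the inequality is sharp on $\mathbb{S}^{n-1}\cup\{0\}$: for every constant $M>0$, if $g(x)=(-2nM,0,\ldots,0)$ and $f(x)=(M(1-|x|^2),0,\ldots,0)$ for $x\in\overline{\mathbb{B}^n}$, then equality holds for every $x\in\mathbb{S}^{n-1}\cup\{0\}$.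
   Context: $\mathbb{B}^n$ is the open unit ball of $\mathbb{R}^n$, $\mathbb{S}^{n-1}$ the unit sphere, $|\cdot|$ the Euclidean norm, and $d\sigma$ the normalized ($\sigma(\mathbb{S}^{n-1})=1$) Lebesgue surface measure on $\mathbb{S}^{n-1}$. The Laplacian $\Delta f=\sum_{k=1}^n \partial^2 f/\partial x_k^2$ is taken componentwise. The Poisson kernel is $P(x,\zeta)=\frac{1-|x|^2}{|x-\zeta|^n}$ for $x\in\mathbb{B}^n$, $\zeta\in\mathbb{S}^{n-1}$, and $\mathcal{P}_f(x)=\int_{\mathbb{S}^{n-1}}P(x,\zeta)f(\zeta)\,d\sigma(\zeta)$ for $x\in\mathbb{B}^n$. For a function $h$ on $\mathbb{B}^n$, $\|h\|_\infty=\sup_{x\in\mathbb{B}^n}|h(x)|$. *)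

(* Defs.v *)
From HB Require Import structures.
From mathcomp Require Import all_boot all_order all_algebra.
From mathcomp Require Import all_classical all_reals all_analysis.
From mathcomp Require Import measurable_realfun.
Import Order.TTheory GRing.Theory Num.Theory.
Import numFieldNormedType.Exports.

Set Implicit Arguments.
Unset Strict Implicit.
Unset Printing Implicit Defensive.

Local Open Scope classical_set_scope.
Local Open Scope ring_scope.

(* The library norm `|x| on 'rV[R]_n is the sup norm; it induces the same
   topology as the Euclidean norm below. *)
Definition enorm (R : realType) (n : nat) (x : 'rV[R]_n) : R :=
  Num.sqrt (\sum_(i < n) x ord0 i ^+ 2).

Definition unit_ball (R : realType) (n : nat) : set 'rV[R]_n :=
  [set x | enorm x < 1].

Definition unit_cball (R : realType) (n : nat) : set 'rV[R]_n :=
  [set x | enorm x <= 1].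

Definition unit_sphere (R : realType) (n : nat) : set 'rV[R]_n :=
  [set x | enorm x = 1].

(* The sigma-algebra on R^n is generated by the coordinate maps into R with its
   Borel sigma-algebra, as the library does for n.-tuple R; it is the Borel
   sigma-algebra of R^n. *)
Definition measure_rV_display : measure_display.
Proof. exact: default_measure_display. Qed.

Section measurable_rV.
Variables (R : realType) (n : nat).

Let coor (i : 'I_n) (x : 'rV[R]_n) : R := x ord0 i.

Let rV_set0 : g_sigma_preimage coor set0.
Proof. exact: sigma_algebra0. Qed.

Let rV_setC A : g_sigma_preimage coor A -> g_sigma_preimage coor (~` A).
Proof. exact: sigma_algebraC. Qed.

Let rV_bigcup (F : _^nat) : (forall i, g_sigma_preimage coor (F i)) ->
  g_sigma_preimage coor (\bigcup_i (F i)).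
Proof. exact: sigma_algebra_bigcup. Qed.

HB.instance Definition _ := @isMeasurable.Build measure_rV_display
  'rV[R]_n (g_sigma_preimage coor) rV_set0 rV_setC rV_bigcup.

End measurable_rV.

Lemma measurable_coord (R : realType) (n : nat) (i : 'I_n) :
  measurable_fun [set: 'rV[R]_n] (fun x : 'rV[R]_n => x ord0 i).
Proof.
move=> _ Y mY; rewrite setTI; apply: sub_sigma_algebra => /=.
rewrite -bigcup_seq/=; exists i => /=; first by rewrite mem_index_enum.
by exists Y => //; rewrite setTI.
Qed.

Lemma measurable_fun_rVP d (T : measurableType d) (R : realType) (n : nat)
    (f : T -> 'rV[R]_n) :
  (forall i, measurable_fun [set: T] (fun t => f t ord0 i)) ->
  measurable_fun [set: T] f.
Proof.
move=> mf _ Y mY; move: Y mY.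
have sub : [set A : set 'rV[R]_n | measurable A] `<=`
    [set A : set 'rV[R]_n | measurable (f @^-1` A)].
  apply: smallest_sub => /=.
    split => /=; first by rewrite preimage_set0.
    - by move=> A mA; rewrite setTD preimage_setC; exact: measurableC.
    - by move=> F mF; rewrite preimage_bigcup; exact: bigcup_measurable.
  move=> A; rewrite -bigcup_seq => -[i _ [B mB <-]] /=.
  rewrite setTI -comp_preimage.
  by have := mf i measurableT B mB; rewrite setTI.
by move=> Y mY; rewrite setTI; exact: sub.
Qed.

(* The isomorphism R x R^n -> R^(n+1). *)
Definition rV_cons (R : realType) (n : nat)
    (u : measurableTypeR R * 'rV[R]_n) : 'rV[R]_n.+1 :=
  @row_mx R 1 1 n (u.1)%:M u.2.

Lemma rV_cons0 (R : realType) (n : nat) (u : measurableTypeR R * 'rV[R]_n) :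
  rV_cons u ord0 ord0 = u.1.
Proof.
rewrite /rV_cons; have -> : (ord0 : 'I_n.+1) = lshift n (ord0 : 'I_1).
  exact/val_inj.
by apply: etrans (row_mxEl _ _ _ _) _; rewrite mxE eqxx mulr1n.
Qed.

Lemma rV_consS (R : realType) (n : nat) (u : measurableTypeR R * 'rV[R]_n) i :
  rV_cons u ord0 (lift ord0 i) = u.2 ord0 i.
Proof.
rewrite /rV_cons; have -> : lift ord0 i = rshift 1 i by exact/val_inj.
exact: row_mxEr.
Qed.

Lemma measurable_rV_cons (R : realType) (n : nat) :
  measurable_fun [set: measurableTypeR R * 'rV[R]_n] (@rV_cons R n).
Proof.
apply: measurable_fun_rVP => i; case: (unliftP ord0 i) => [j ->|->].
- under eq_fun do rewrite rV_consS.
  exact: (measurableT_comp (measurable_coord j) measurable_snd).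
- under eq_fun do rewrite rV_cons0.
  exact: measurable_fst.
Qed.

Definition rV_uncons (R : realType) (n : nat) (x : 'rV[R]_n.+1) :
    measurableTypeR R * 'rV[R]_n :=
  (x ord0 ord0, \row_i x ord0 (lift ord0 i)).

Lemma rV_consK (R : realType) (n : nat) :
  cancel (@rV_cons R n) (@rV_uncons R n).
Proof.
move=> [a v]; rewrite /rV_uncons rV_cons0; congr (_, _).
by apply/rowP => i; rewrite mxE rV_consS.
Qed.

Lemma measurable_rV_uncons (R : realType) (n : nat) :
  measurable_fun [set: 'rV[R]_n.+1] (@rV_uncons R n).
Proof.
apply/measurable_fun_pairP; split; first exact: (measurable_coord ord0).
apply: measurable_fun_rVP => i /=.
under eq_fun do rewrite mxE.
exact: measurable_coord.
Qed.

Section lebesgue_rV_step.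
Local Open Scope ereal_scope.
Variables (R : realType) (n : nat).
Variable mu : {sigma_finite_measure set 'rV[R]_n -> \bar R}.

Definition lebesgue_rV_step : set 'rV[R]_n.+1 -> \bar R :=
  pushforward (lebesgue_measure \x mu) (@rV_cons R n).

Let preim_cons (A : set 'rV[R]_n.+1) : measurable A ->
  measurable (@rV_cons R n @^-1` A).
Proof.
by move=> mA; rewrite -[X in measurable X]setTI; exact: measurable_rV_cons.
Qed.

Let step0 : lebesgue_rV_step set0 = 0.
Proof. by rewrite /lebesgue_rV_step /pushforward preimage_set0 measure0. Qed.

Let step_ge0 A : 0 <= lebesgue_rV_step A.
Proof. exact: (measure_ge0 (lebesgue_measure \x mu)). Qed.

Let step_sigma_additive : semi_sigma_additive lebesgue_rV_step.
Proof.
move=> F mF tF mUF; rewrite /lebesgue_rV_step /pushforward preimage_bigcup.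
apply: measure_semi_sigma_additive.
- by move=> k; exact: preim_cons.
- apply/trivIsetP => /= i j _ _ ij; rewrite -preimage_setI.
  by move/trivIsetP : tF => /(_ _ _ _ _ ij) ->//; rewrite preimage_set0.
- by rewrite -preimage_bigcup; exact: preim_cons.
Qed.

HB.instance Definition _ := isMeasure.Build _ _ _ lebesgue_rV_step
  step0 step_ge0 step_sigma_additive.

Let step_sigma_finite : sigma_finite setT lebesgue_rV_step.
Proof.
have /sigma_finiteP[F [TF ndF Foo]] :=
  sigma_finiteT (@lebesgue_measure R).
have /sigma_finiteP[G [TG ndG Goo]] := sigma_finiteT mu.
exists (fun k => @rV_uncons R n @^-1` (F k `*` G k)).
  apply/esym; rewrite -subTset => x _ /=.
  have [i _ Fi] : (\bigcup_i F i) (rV_uncons x).1 by rewrite -TF.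
  have [j _ Gj] : (\bigcup_i G i) (rV_uncons x).2 by rewrite -TG.
  exists (maxn i j) => //; split => /=.
    by move: Fi; apply/subsetPset/ndF/leq_maxl.
  by move: Gj; apply/subsetPset/ndG/leq_maxr.
move=> k; have [mF Fk] := Foo k; have [mG Gk] := Goo k; split.
  rewrite -[X in measurable X]setTI; apply: measurable_rV_uncons => //.
  exact: measurableX.
rewrite /lebesgue_rV_step /pushforward -comp_preimage.
rewrite (_ : _ \o _ = id); last first.
  by apply/funext => u /=; rewrite rV_consK.
by rewrite preimage_id product_measure1E// lte_mul_pinfty// ge0_fin_numE.
Qed.

HB.instance Definition _ := Measure_isSigmaFinite.Build _ _ _
  lebesgue_rV_step step_sigma_finite.

End lebesgue_rV_step.

(* Lebesgue measure on R^n, as the n-fold product of Lebesgue measure on R. *)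
Fixpoint lebesgue_rV (R : realType) (n : nat) :
    {sigma_finite_measure set 'rV[R]_n -> \bar R} :=
  match n return {sigma_finite_measure set 'rV[R]_n -> \bar R} with
  | 0 => \d_(0 : 'rV[R]_0)
  | n'.+1 => lebesgue_rV_step (lebesgue_rV R n')
  end.

Lemma measurable_inv (R : realType) :
  measurable_fun [set: R] (fun r : R => r^-1).
Proof.
rewrite -(setvU [set 0 : R]); apply/measurable_funU; [|exact: measurable_set1|].
- exact: measurableC.
- split; last exact: measurable_fun_set1.
  apply: open_continuous_measurable_fun.
    by apply: closed_openC; exact: closed_eq.
  by move=> r; rewrite inE /= => /eqP r0; exact: inv_continuous.
Qed.

Lemma measurable_enorm (R : realType) (n : nat) :
  measurable_fun [set: 'rV[R]_n] (@enorm R n).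
Proof.
apply: measurableT_comp.
  by apply: continuous_measurable_fun; exact: sqrt_continuous.
apply: measurable_sum => i; apply: measurable_funX.
exact: measurable_coord.
Qed.

Lemma measurable_unit_ball (R : realType) (n : nat) :
  measurable (@unit_ball R n).
Proof.
rewrite (_ : @unit_ball R n = @enorm R n @^-1` `]-oo, 1[); last first.
  by apply/seteqP; split => x /=; rewrite in_itv.
by rewrite -[X in measurable X]setTI; exact: measurable_enorm.
Qed.

(* Radial projection onto the unit sphere; its value 0 at the origin is
   irrelevant, the origin being negligible. *)
Definition radial_proj (R : realType) (n : nat) (x : 'rV[R]_n) : 'rV[R]_n :=
  (enorm x)^-1 *: x.

Lemma measurable_radial_proj (R : realType) (n : nat) :
  measurable_fun [set: 'rV[R]_n] (@radial_proj R n).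
Proof.
apply: measurable_fun_rVP => i.
under eq_fun do rewrite mxE.
apply: measurable_funM; last exact: measurable_coord.
apply: (@measurable_comp _ _ _ _ _ _ setT (fun r : R => r^-1)) => //.
  exact: measurable_inv.
exact: measurable_enorm.
Qed.

Section sphere_measure.
Local Open Scope ereal_scope.
Variables (R : realType) (n : nat).

Definition cone_measure (A : set 'rV[R]_n) : \bar R :=
  lebesgue_rV R n (@unit_ball R n `&` @radial_proj R n @^-1` A).

Let preim_proj (A : set 'rV[R]_n) : measurable A ->
  measurable (@unit_ball R n `&` @radial_proj R n @^-1` A).
Proof.
move=> mA; apply: measurableI; first exact: measurable_unit_ball.
by rewrite -[X in measurable X]setTI; exact: measurable_radial_proj.
Qed.

Let cone0 : cone_measure set0 = 0.
Proof. by rewrite /cone_measure preimage_set0 setI0 measure0. Qed.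

Let cone_ge0 A : 0 <= cone_measure A.
Proof. exact: measure_ge0. Qed.

Let cone_sigma_additive : semi_sigma_additive cone_measure.
Proof.
move=> F mF tF mUF; rewrite /cone_measure preimage_bigcup setI_bigcupr.
apply: measure_semi_sigma_additive.
- by move=> k; exact: preim_proj.
- apply/trivIsetP => /= i j _ _ ij; rewrite setIACA setIid -preimage_setI.
  move/trivIsetP : tF => /(_ _ _ _ _ ij) ->//.
  by rewrite preimage_set0 setI0.
- by rewrite -setI_bigcupr -preimage_bigcup; exact: preim_proj.
Qed.

HB.instance Definition _ := isMeasure.Build _ _ _ cone_measure
  cone0 cone_ge0 cone_sigma_additive.

(* Normalized surface measure: for A in the unit sphere,
     sigma(A) = |{t z : z in A, 0 < t < 1}| / |unit ball|
   (integration in polar coordinates).  The second argument of mnormalize is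
   used only when the total mass is 0 or +oo, which is not the case here. *)
Definition sphere_measure : probability 'rV[R]_n R :=
  mnormalize cone_measure \d_(0%R : 'rV[R]_n).

End sphere_measure.

Definition poisson_kernel (R : realType) (n : nat) (x z : 'rV[R]_n) : R :=
  (1 - enorm x ^+ 2) / enorm (x - z) ^+ n.

Definition poisson_integral (R : realType) (n m : nat)
    (f : 'rV[R]_n -> 'rV[R]_m) (x : 'rV[R]_n) : 'rV[R]_m :=
  \row_(j < m) \int[sphere_measure R n]_(z in @unit_sphere R n)
    (poisson_kernel x z * f z ord0 j).

(* Only applied to functions that are bounded on the unit ball, where the real
   supremum is the actual one. *)
Definition sup_norm (R : realType) (n m : nat)
    (h : 'rV[R]_n -> 'rV[R]_m) : R :=
  sup [set enorm (h x) | x in @unit_ball R n].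

Definition partial (R : realType) (n : nat) (i : 'I_n) (h : 'rV[R]_n -> R) :
    'rV[R]_n -> R :=
  fun x => 'D_(delta_mx ord0 i) h x.

Definition laplacian (R : realType) (n : nat) (h : 'rV[R]_n -> R)
    (x : 'rV[R]_n) : R :=
  \sum_(k < n) partial k (partial k h) x.

Definition vec_laplacian (R : realType) (n m : nat)
    (f : 'rV[R]_n -> 'rV[R]_m) (x : 'rV[R]_n) : 'rV[R]_m :=
  \row_(j < m) laplacian (fun y => f y ord0 j) x.

(* Meant for U open. *)
Definition class_C2 (R : realType) (n : nat) (U : set 'rV[R]_n)
    (h : 'rV[R]_n -> R) : Prop :=
  forall x, U x ->
  [/\ {for x, continuous h},
      forall i, derivable h x (delta_mx ord0 i) /\
        {for x, continuous (partial i h)} &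
      forall i j, derivable (partial i h) x (delta_mx ord0 j) /\
        {for x, continuous (partial j (partial i h))}].

Definition vec_class_C2 (R : realType) (n m : nat) (U : set 'rV[R]_n)
    (f : 'rV[R]_n -> 'rV[R]_m) : Prop :=
  forall j : 'I_m, class_C2 U (fun x => f x ord0 j).

(* Functions on the closed ball are represented by total functions, of which
   only the values on the closed ball matter. *)
Definition poisson_solution (R : realType) (n m : nat)
    (g f : 'rV[R]_n -> 'rV[R]_m) : Prop :=
  [/\ {within @unit_cball R n, continuous g},
      {within @unit_cball R n, continuous f},
      vec_class_C2 (@unit_ball R n) f &
      forall x, unit_ball x -> vec_laplacian f x = g x].

Definition first_coord (R : realType) (m : nat) (c : R) : 'rV[R]_m :=
  \row_(j < m) (if j == 0 :> nat then c else 0).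

(* Main.v *)
Require Import Defs.
From HB Require Import structures.
From mathcomp Require Import all_boot all_order all_algebra.
From mathcomp Require Import all_classical all_reals all_analysis.
From mathcomp Require Import measurable_realfun.
From mathcomp Require Import ring lra.
Import Order.TTheory GRing.Theory Num.Theory.
Import numFieldNormedType.Exports.

(** Write P[f] for the Poisson integral of the boundary values of f, N for the
    supremum of |P[f]| over the ball, G for that of |g|, and
    c = (1 - |x|) / (1 + |x|)^(n-1).

    The estimate is the sum of two. First, f stays close to P[f]: if e is a unit
    vector then h = e . f + G |x|^2 / (2 n) has Laplacian e . g + G >= 0, so that
    h - P[h] is subharmonic and vanishes on the sphere; by the maximum principle
    h <= P[h], that is e . f <= e . P[f] + G (1 - |x|^2) / (2 n)
    (solution_le_poisson). Second, P(x, z) >= c because |x - z| <= 1 + |x|,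
    whereas P(0, z) = 1; hence e . (P[f](x) - c P[f](0)) is the integral of
    e . f against the nonnegative kernel P(x, -) - c of mass 1 - c, and is at most
    N (1 - c) since |f| <= N on the sphere (poisson_schwarz,
    boundary_le_sup_norm). Taking e in the direction of f(x) - c P[f](0) gives
    the inequality. On the sphere c = 0 and only |f| <= N is left.

    Three facts about the Poisson kernel carry this. It is harmonic in x, and
    P[f] inherits this by differentiation under the integral
    (kernel_integral_derive, poisson_kernel_laplacian). It has total mass 1: the
    mass is a harmonic function of x which is radial, so the maximum principle
    makes it constant, equal to its value at 0 (poisson_mass). And P[f] extends
    continuously to f on the sphere, because the mass concentrates
    (poisson_boundary).

    That the mass is radial rests on the rotation invariance of the surface
    measure, hence of Lebesgue measure. The latter is built one coordinate at a
    time, so that shears along the first coordinate preserve it by Fubini and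
    translation invariance; and a plane rotation is a product of three shears
    (rigid_plane_rotation, rigid_transitive).

    For the extremal f = (M (1 - |x|^2), 0, ..., 0) the boundary values vanish,
    hence so do P[f] and N, and both sides equal M (1 - |x|^2). *)

Set Implicit Arguments.
Unset Strict Implicit.
Unset Printing Implicit Defensive.

Local Open Scope classical_set_scope.
Local Open Scope ring_scope.

(** * The Euclidean norm *)

Section euclidean.
Variables (R : realType) (n : nat).
Implicit Types (x y z : 'rV[R]_n).

Definition dot x y : R := \sum_(i < n) x ord0 i * y ord0 i.

Lemma dotC x y : dot x y = dot y x.
Proof. by apply: eq_bigr => i _; rewrite mulrC. Qed.

Lemma dotDr x y z : dot x (y + z) = dot x y + dot x z.
Proof. by rewrite -big_split; apply: eq_bigr => i _; rewrite mxE mulrDr. Qed.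

Lemma dotDl x y z : dot (x + y) z = dot x z + dot y z.
Proof. by rewrite dotC dotDr !(dotC z). Qed.

Lemma dotZr (c : R) x y : dot x (c *: y) = c * dot x y.
Proof. by rewrite mulr_sumr; apply: eq_bigr => i _; rewrite mxE mulrCA. Qed.

Lemma dotZl (c : R) x y : dot (c *: x) y = c * dot x y.
Proof. by rewrite dotC dotZr dotC. Qed.

Lemma dotNr x y : dot x (- y) = - dot x y.
Proof. by rewrite -scaleN1r dotZr mulN1r. Qed.

Lemma dotNl x y : dot (- x) y = - dot x y.
Proof. by rewrite dotC dotNr dotC. Qed.

Lemma dot0l x : dot 0 x = 0.
Proof. by rewrite -(scale0r 0) dotZl mul0r. Qed.

Lemma dot0r x : dot x 0 = 0.
Proof. by rewrite dotC dot0l. Qed.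

Lemma enormE x : enorm x = Num.sqrt (dot x x).
Proof. by rewrite /enorm; congr Num.sqrt; apply: eq_bigr => i _; rewrite expr2. Qed.

Lemma dot_ge0 x : 0 <= dot x x.
Proof. by apply: sumr_ge0 => i _; rewrite -expr2 sqr_ge0. Qed.

Lemma enorm_sqr x : enorm x ^+ 2 = dot x x.
Proof. by rewrite enormE sqr_sqrtr// dot_ge0. Qed.

Lemma enorm_ge0 x : 0 <= enorm x.
Proof. exact: sqrtr_ge0. Qed.

Lemma ler_coord_enorm x i : `|x ord0 i| <= enorm x.
Proof.
rewrite /enorm -sqrtr_sqr ler_wsqrtr// (bigD1 i)//= lerDl.
by apply: sumr_ge0 => j _; exact: sqr_ge0.
Qed.

Lemma enorm_eq0 x : (enorm x == 0) = (x == 0).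
Proof.
apply/eqP/eqP => [x0|->]; last by rewrite enormE dot0l sqrtr0.
apply/rowP => i; apply/eqP; rewrite mxE -normr_le0.
by rewrite (le_trans (ler_coord_enorm x i))// x0.
Qed.

Lemma enorm0 : enorm (0 : 'rV[R]_n) = 0.
Proof. by apply/eqP; rewrite enorm_eq0. Qed.

Lemma enormZ (c : R) x : enorm (c *: x) = `|c| * enorm x.
Proof.
by rewrite !enormE dotZl dotZr mulrA -expr2 sqrtrM ?sqr_ge0// sqrtr_sqr.
Qed.

Lemma enormN x : enorm (- x) = enorm x.
Proof. by rewrite -scaleN1r enormZ normrN1 mul1r. Qed.

Lemma enormB x y : enorm (x - y) = enorm (y - x).
Proof. by rewrite -enormN opprB. Qed.

Lemma dot_le x y : dot x y <= enorm x * enorm y.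
Proof.
have [->|x0] := eqVneq x 0; first by rewrite dot0l enorm0 mul0r.
have [->|y0] := eqVneq y 0; first by rewrite dot0r enorm0 mulr0.
have {}x0 : 0 < enorm x by rewrite lt_def enorm_eq0 x0 enorm_ge0.
have {}y0 : 0 < enorm y by rewrite lt_def enorm_eq0 y0 enorm_ge0.
have := dot_ge0 (enorm y *: x - enorm x *: y).
rewrite dotDr !dotDl !(dotNl, dotNr, dotZl, dotZr) (dotC y x) -!enorm_sqr.
set a := enorm x; set b := enorm y; set c := dot x y => h.
rewrite -subr_ge0 -(pmulr_rge0 _ (mulr_gt0 x0 y0)) -/a -/b.
lra.
Qed.

Lemma ler_enormD x y : enorm (x + y) <= enorm x + enorm y.
Proof.
rewrite -(@ler_pXn2r _ 2)// ?nnegrE ?addr_ge0 ?enorm_ge0//.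
rewrite enorm_sqr dotDr !dotDl (dotC y x) sqrrD -!enorm_sqr.
have := dot_le x y; lra.
Qed.

Lemma ler_enormB x y : enorm x - enorm y <= enorm (x - y).
Proof. by rewrite lerBlDr (le_trans _ (ler_enormD _ _))// subrK. Qed.

Lemma enorm_delta (i : 'I_n) : enorm (delta_mx ord0 i : 'rV[R]_n) = 1.
Proof.
rewrite /enorm (bigD1 i)//= big1 => [|j ji]; rewrite mxE ?eqxx//=.
  by rewrite expr1n addr0 sqrtr1.
by rewrite (negbTE ji) expr0n.
Qed.

Lemma dot_delta x (i : 'I_n) : dot x (delta_mx ord0 i) = x ord0 i.
Proof.
rewrite /dot (bigD1 i)//= big1 => [|j ji]; rewrite mxE ?eqxx//=.
  by rewrite mulr1 addr0.
by rewrite (negbTE ji) mulr0.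
Qed.

Lemma enorm_line x i (t : R) :
  enorm (x + t *: delta_mx ord0 i) ^+ 2 = enorm x ^+ 2 + 2 * x ord0 i * t + t ^+ 2.
Proof.
rewrite enorm_sqr dotDr !dotDl !(dotZl, dotZr) (dotC _ x) dot_delta.
by rewrite -!enorm_sqr enorm_delta; ring.
Qed.

(** Testing a vector against its direction turns estimates of its norm into
    scalar ones. The bound is not an equality because of the zero vector. *)
Lemma unit_direction x : exists2 e, enorm e <= 1 & dot e x = enorm x.
Proof.
have [->|x0] := eqVneq x 0; first by exists 0; rewrite ?dot0l enorm0.
exists ((enorm x)^-1 *: x).
  by rewrite enormZ ger0_norm ?invr_ge0 ?enorm_ge0// mulVf// enorm_eq0.
by rewrite dotZl -enorm_sqr expr2 mulKf// enorm_eq0.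
Qed.

Lemma continuous_enorm : continuous (@enorm R n).
Proof.
have c : continuous (fun x : 'rV[R]_n => \sum_(i < n) x ord0 i ^+ 2).
  apply: continuous_big => [|i _ x]; first exact: add_continuous.
  apply: (@continuous_comp _ _ _ (fun x : 'rV[R]_n => x ord0 i) (fun t => t ^+ 2)).
    exact: coord_continuous.
  exact: exprn_continuous.
by move=> x; apply: (continuous_comp (c x)); exact: sqrt_continuous.
Qed.

Lemma continuous_enorm_sqr : continuous (fun x : 'rV[R]_n => enorm x ^+ 2).
Proof.
move=> x; apply: (@continuous_comp _ _ _ (@enorm R n) (fun t => t ^+ 2)).
  exact: continuous_enorm.
exact: exprn_continuous.
Qed.

Lemma near_enorm_lt x (e : R) : 0 < e -> \forall y \near x, enorm (y - x) < e.
Proof.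
move=> e0; have c : {for x, continuous (fun y : 'rV[R]_n => enorm (y - x))}.
  apply: (@continuous_comp _ _ _ (fun y : 'rV[R]_n => y - x) (@enorm R n)).
    by apply: continuousB; [exact: cvg_id|exact: cst_continuous].
  exact: continuous_enorm.
by apply: (cvgr_lt _ c); rewrite subrr enorm0.
Qed.

Lemma mx_norm_le_enorm x : `|x| <= enorm x.
Proof.
have [->|x0] := eqVneq x 0; first by rewrite normr0 enorm_ge0.
have /mx_norm_neq0[[i j] /= h] : mx_norm x != 0 by move: x0; rewrite -normr_eq0.
by rewrite [leLHS]h (ord1 i) ler_coord_enorm.
Qed.

Lemma closed_ball_compact (r : R) : compact [set x : 'rV[R]_n | enorm x <= r].
Proof.
apply: bounded_closed_compact.
  exists r; split; first by rewrite num_real.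
  by move=> s rs x /= xr; rewrite (le_trans (mx_norm_le_enorm x))// (le_trans xr)// ltW.
rewrite (_ : [set _ | _] = @enorm R n @^-1` [set t | t <= r])//.
by apply: closed_comp => [x _|]; [exact: continuous_enorm|exact: closed_le].
Qed.

Lemma sphere_compact (r : R) : compact [set x : 'rV[R]_n | enorm x = r].
Proof.
apply: (subclosed_compact _ (@closed_ball_compact r)) => [|x /= -> //].
rewrite (_ : [set _ | _] = @enorm R n @^-1` [set t | t = r])//.
by apply: closed_comp => [x _|]; [exact: continuous_enorm|exact: closed_eq].
Qed.

Lemma open_ball_open (r : R) : open [set x : 'rV[R]_n | enorm x < r].
Proof.
rewrite (_ : [set _ | _] = @enorm R n @^-1` [set t | t < r])//.
by apply: open_comp => [x _|]; [exact: continuous_enorm|exact: open_lt].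
Qed.

End euclidean.

(** * Borel measurability in R^n *)

Section borel_rV.
Variables (R : realType) (n : nat).

(** An open set is the union of the boxes with rational vertices that it
    contains, and a box is a finite intersection of preimages of intervals under
    coordinates. *)
Lemma open_measurable_rV (U : set 'rV[R]_n) : open U -> measurable U.
Proof.
move=> oU.
pose box (ab : 'rV[rat]_n * 'rV[rat]_n) : set 'rV[R]_n :=
  [set y | forall i, ratr (ab.1 ord0 i) < y ord0 i < ratr (ab.2 ord0 i)].
have mbox ab : measurable (box ab).
  rewrite (_ : box ab = \bigcap_(i in [set: 'I_n])
     (fun y : 'rV[R]_n => y ord0 i) @^-1` `]ratr (ab.1 ord0 i), ratr (ab.2 ord0 i)[).
    apply: fin_bigcap_measurable => // i _.
    rewrite -[X in measurable X]setTI.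
    exact: measurable_coord.
  apply/seteqP; split => y /= h i; last by have := h i I; rewrite /= in_itv.
  by move=> _ /=; rewrite in_itv/= h.
have -> : U = \bigcup_ab (if `[< box ab `<=` U >] then box ab else set0).
  apply/seteqP; split => x; last first.
    by move=> [ab _]; case: asboolP => // h /h.
  move=> Ux; have /nbhs_ballP[e /= e0 xeU] : nbhs x U by exact: open_nbhs_nbhs.
  have /choice[a ha] i : exists q : rat, ratr q \in `]x ord0 i - e, x ord0 i[.
    by have [|q qi] := @rat_in_itvoo R (x ord0 i - e) (x ord0 i);
      [rewrite gtrBl|exists q].
  have /choice[b hb] i : exists q : rat, ratr q \in `]x ord0 i, x ord0 i + e[.
    by have [|q qi] := @rat_in_itvoo R (x ord0 i) (x ord0 i + e);
      [rewrite ltrDl|exists q].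
  exists (\row_i a i, \row_i b i) => //.
  have xbox : box (\row_i a i, \row_i b i) x.
    move=> i /=; rewrite !mxE.
    by have := ha i; have := hb i; rewrite !in_itv/= => /andP[-> _] /andP[_ ->].
  case: asboolP => // -[] y ybox; apply: xeU; split => // i j.
  rewrite (ord1 i) {i}/=; have := ybox j; rewrite /= !mxE.
  have := ha j; have := hb j; rewrite !in_itv/= => /andP[_ h1] /andP[h2 _] /andP[h3 h4].
  by rewrite /ball/= ltr_norml; apply/andP; split; lra.
apply: countable_bigcupT_measurable => // ab; case: ifP => // _.
Qed.

(** Preimages of open sets are only relatively open in D, hence the
    measurability of D. *)
Lemma continuous_within_measurable (D : set 'rV[R]_n) (h : 'rV[R]_n -> R) :
  measurable D -> {within D, continuous h} -> measurable_fun D h.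
Proof.
move=> mD /continuousP ch; apply: (measurability _ (RGenOpens.measurableE R)).
move=> _ [_ [a [b ->] <-]].
have oab : open `]a, b[%classic by exact: interval_open.
have := ch _ oab; move=> /open_subspaceP[V oV VD].
rewrite setIC -VD; apply: measurableI => //; exact: open_measurable_rV.
Qed.

End borel_rV.

(** * Rotation invariance of Lebesgue measure *)

Definition preserves d (T : measurableType d) (R : realType)
    (mu : set T -> \bar R) (f : T -> T) : Prop :=
  measurable_fun [set: T] f /\
  forall A, measurable A -> mu (f @^-1` A) = mu A.

Lemma preserves_comp d (T : measurableType d) (R : realType)
    (mu : set T -> \bar R) (f g : T -> T) :
  preserves mu f -> preserves mu g -> preserves mu (f \o g).
Proof.
move=> [mf pf] [mg pg]; split; first exact: measurableT_comp.
move=> A mA; rewrite comp_preimage pg ?pf//.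
by rewrite -[X in measurable X]setTI; exact: mf.
Qed.

Section product_shears.
Context d1 d2 (T1 : measurableType d1) (T2 : measurableType d2) (R : realType).
Variable m1 : {sigma_finite_measure set T1 -> \bar R}.
Variable m2 : {sigma_finite_measure set T2 -> \bar R}.

(** By Fubini, a map of a product that moves points only inside the fibers
    preserves the product measure as soon as it preserves the measure of each
    fiber. The map on a fiber may depend on the fiber: for translations one
    obtains shears. *)
Lemma preserves_fiber2 (g : T1 -> T2 -> T2) :
  measurable_fun [set: T1 * T2] (fun u => g u.1 u.2) ->
  (forall x, preserves m2 (g x)) ->
  preserves (m1 \x m2)%E (fun u => (u.1, g u.1 u.2)).
Proof.
move=> mg pg; split; first exact: measurable_fun_pair.
move=> A mA; apply: eq_integral => x _ /=.
rewrite -[RHS](pg x).2; last exact: measurable_xsection.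
by congr (m2 _); rewrite !xsectionE.
Qed.

Lemma preserves_fiber1 (g : T2 -> T1 -> T1) :
  measurable_fun [set: T1 * T2] (fun u => g u.2 u.1) ->
  (forall y, preserves m1 (g y)) ->
  preserves (m1 \x m2)%E (fun u => (g u.2 u.1, u.2)).
Proof.
move=> mg pg; have mG : measurable_fun [set: T1 * T2] (fun u => (g u.2 u.1, u.2)).
  exact: measurable_fun_pair.
split => // A mA.
have swap B : measurable B -> (m1 \x m2)%E B = (m1 \x^ m2)%E B.
  apply: (@product_measure_unique _ _ _ _ _ m1 m2 (m1 \x^ m2)%E) => {}A1 A2 mA1 mA2.
  exact: product_measure2E.
rewrite !swap//; last by rewrite -[X in measurable X]setTI; exact: mG.
apply: eq_integral => y _ /=.
rewrite -[RHS](pg y).2; last exact: measurable_ysection.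
by congr (m1 _); rewrite !ysectionE.
Qed.

End product_shears.

Section translations.
Variable R : realType.

(** By uniqueness of Lebesgue measure only half-open intervals matter. *)
Lemma lebesgue_translation (a : R) :
  preserves (@lebesgue_measure R) (fun t : measurableTypeR R => t + a).
Proof.
have mf : measurable_fun [set: measurableTypeR R] (fun t : measurableTypeR R => t + a).
  by apply: measurable_funD => //; exact: measurable_id.
split => // A mA.
pose f : measurableTypeR R -> measurableTypeR R := fun t => t + a.
transitivity (pushforward lebesgue_measure f A) => //.
apply/esym/(lebesgue_measure_unique (mu := pushforward lebesgue_measure f)) => //=.
move=> _ [[u v]] _ <- /=.
rewrite /pushforward (_ : _ @^-1` _ = `]u - a, v - a]%classic).
  by rewrite !lebesgue_measure_itv/= !lte_fin ltrD2r; case: ifP => // _;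
    rewrite -!EFinB; congr (_%:E); ring.
by apply/seteqP; split => t /=; rewrite !in_itv/= ltrBlDr lerBrDr.
Qed.

Lemma rV_unconsK n : cancel (@rV_uncons R n) (@rV_cons R n).
Proof.
move=> x; apply/rowP => i; case: (unliftP ord0 i) => [j ->|->].
  by rewrite rV_consS mxE.
by rewrite rV_cons0.
Qed.

(** Lebesgue measure on R^(n+1) is a product measure carried over by rV_cons. *)
Lemma preserves_rV n (F : measurableTypeR R * 'rV[R]_n -> measurableTypeR R * 'rV[R]_n)
    (T : 'rV[R]_n.+1 -> 'rV[R]_n.+1) :
  preserves (lebesgue_measure \x lebesgue_rV R n)%E F ->
  (forall u, T (rV_cons u) = rV_cons (F u)) ->
  preserves (lebesgue_rV R n.+1) T.
Proof.
move=> [mF pF] TF; split.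
  rewrite (_ : T = @rV_cons R n \o F \o @rV_uncons R n).
    apply: measurableT_comp; last exact: measurable_rV_uncons.
    by apply: measurableT_comp => //; exact: measurable_rV_cons.
  by apply/funext => x /=; rewrite -TF rV_unconsK.
move=> A mA /=; rewrite /lebesgue_rV_step /pushforward -[RHS]pF.
  by congr (product_measure1 _ _ _); apply/funext => u /=; rewrite TF.
by rewrite -[X in measurable X]setTI; exact: measurable_rV_cons.
Qed.

Lemma measurable_translation n (v : 'rV[R]_n) :
  measurable_fun setT (fun x : 'rV[R]_n => x + v).
Proof.
apply: measurable_fun_rVP => i; under eq_fun do rewrite mxE.
by apply: measurable_funD => //; exact: measurable_coord.
Qed.

Lemma lebesgue_rV_translation n (v : 'rV[R]_n) :
  preserves (lebesgue_rV R n) (fun x => x + v).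
Proof.
elim: n v => [|n IH] v.
  rewrite (_ : (fun x => x + v) = id); first by split.
  by apply/funext => x; apply/rowP => -[].
pose v' : 'rV[R]_n := \row_j v ord0 (lift ord0 j).
have p1 := @preserves_fiber1 _ _ _ _ _ (@lebesgue_measure R) (lebesgue_rV R n)
  (fun _ t => t + v ord0 ord0).
have p2 := @preserves_fiber2 _ _ _ _ _ (@lebesgue_measure R) (lebesgue_rV R n)
  (fun _ y => y + v').
apply: (preserves_rV (preserves_comp (p1 _ _) (p2 _ _))).
- by apply: measurable_funD => //; exact: measurable_fst.
- by move=> _; exact: lebesgue_translation.
- by apply: (measurableT_comp (measurable_translation v')); exact: measurable_snd.
- by move=> _; exact: IH.
move=> [t y]; apply/rowP => i; rewrite mxE/=; case: (unliftP ord0 i) => [j ->|->].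
  by rewrite !rV_consS/= !mxE.
by rewrite !rV_cons0.
Qed.

End translations.

Section rotations.
Variables (R : realType) (n : nat).
Notation e0 := (delta_mx ord0 ord0 : 'rV[R]_n.+1).
Implicit Types (a b x : 'rV[R]_n.+1).

Lemma dot_rV_cons b (u : measurableTypeR R * 'rV[R]_n) : b ord0 ord0 = 0 ->
  dot b (rV_cons u) = dot (\row_j b ord0 (lift ord0 j)) u.2.
Proof.
move=> b0; rewrite /dot big_ord_recl b0 mul0r add0r.
by apply: eq_bigr => i _; rewrite rV_consS mxE.
Qed.

Lemma measurable_dot m (b : 'rV[R]_m) : measurable_fun setT (dot b).
Proof.
apply: measurable_sum => i; apply: measurable_funM => //; exact: measurable_coord.
Qed.

Lemma preserves_shear1 b : b ord0 ord0 = 0 ->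
  preserves (lebesgue_rV R n.+1) (fun x => x + dot b x *: e0).
Proof.
move=> b0; pose b' : 'rV[R]_n := \row_j b ord0 (lift ord0 j).
have p1 := @preserves_fiber1 _ _ _ _ _ (@lebesgue_measure R) (lebesgue_rV R n)
  (fun y t => t + dot b' y).
apply: (preserves_rV (p1 _ _)).
- apply: measurable_funD; first exact: measurable_fst.
  by apply: (measurableT_comp (measurable_dot b')); exact: measurable_snd.
- by move=> y; exact: lebesgue_translation.
move=> u; apply/rowP => i.
rewrite [LHS]mxE [X in _ + X]mxE [X in _ * X]mxE dot_rV_cons//=.
case: (unliftP ord0 i) => [j ->|->].
  by rewrite !rV_consS/= mulr0 addr0.
by rewrite !rV_cons0/= mulr1.
Qed.

Lemma preserves_shear2 a : a ord0 ord0 = 0 ->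
  preserves (lebesgue_rV R n.+1) (fun x => x + x ord0 ord0 *: a).
Proof.
move=> a0; pose a' : 'rV[R]_n := \row_j a ord0 (lift ord0 j).
have p2 := @preserves_fiber2 _ _ _ _ _ (@lebesgue_measure R) (lebesgue_rV R n)
  (fun t y => y + t *: a').
apply: (preserves_rV (p2 _ _)).
- apply: measurable_fun_rVP => i; under eq_fun do rewrite !mxE.
  apply: measurable_funD.
    by apply: (measurableT_comp (measurable_coord i)); exact: measurable_snd.
  by apply: measurable_funM => //; exact: measurable_fst.
- by move=> t; exact: lebesgue_rV_translation.
move=> u; apply/rowP => i; rewrite [LHS]mxE [X in _ + X]mxE rV_cons0.
case: (unliftP ord0 i) => [j ->|->].
  by rewrite !rV_consS/= !mxE.
by rewrite !rV_cons0/= a0 mulr0 addr0.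
Qed.

(** Linearity is recorded only through differences and dilations, which is what
    the Poisson kernel and the radial projection involve. *)
Record rigid (T : 'rV[R]_n.+1 -> 'rV[R]_n.+1) : Prop := Rigid {
  rigid_preserves : preserves (lebesgue_rV R n.+1) T;
  rigidB : forall x y, T (x - y) = T x - T y;
  rigidZ : forall c x, T (c *: x) = c *: T x;
  rigid_enorm : forall x, enorm (T x) = enorm x }.

Lemma rigid_comp S T : rigid S -> rigid T -> rigid (S \o T).
Proof.
move=> [pS BS ZS eS] [pT BT ZT eT]; split => //=.
- exact: preserves_comp.
- by move=> x y; rewrite BT BS.
- by move=> c x; rewrite ZT ZS.
- by move=> x; rewrite eS eT.
Qed.

(** Rotation by the angle of cosine c and sine s in the plane of e0 and a. *)
Definition plane_rotation a (c s : R) x : 'rV[R]_n.+1 :=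
  x + ((c - 1) * x ord0 ord0 - s * dot a x) *: e0
    + (s * x ord0 ord0 + (c - 1) * dot a x) *: a.

(** A plane rotation is the product of three shears, with parameters
    - t, s, - t where t = s / (1 + c) is the tangent of half the angle. *)
Lemma rigid_plane_rotation a (c s : R) : enorm a = 1 -> a ord0 ord0 = 0 ->
  c ^+ 2 + s ^+ 2 = 1 -> 1 + c != 0 -> rigid (plane_rotation a c s).
Proof.
move=> a1 a0 cs c1.
have aa : dot a a = 1 by rewrite -enorm_sqr a1 expr1n.
have e00 : e0 ord0 ord0 = 1 by rewrite mxE eqxx.
have ae : dot a e0 = 0 by rewrite dot_delta.
split.
- pose t := s / (1 + c).
  have st : s * t = 1 - c.
    by rewrite /t mulrA -expr2 -[s ^+ 2](addKr (c ^+ 2)) cs; field.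
  have tc : t * (1 + c) = s by rewrite /t mulfVK.
  have p1 : preserves (lebesgue_rV R n.+1) (fun x => x + dot (- t *: a) x *: e0).
    by apply: preserves_shear1; rewrite mxE a0 mulr0.
  have p2 : preserves (lebesgue_rV R n.+1) (fun x => x + x ord0 ord0 *: (s *: a)).
    by apply: preserves_shear2; rewrite mxE a0 mulr0.
  rewrite (_ : plane_rotation a c s = (fun x => x + dot (- t *: a) x *: e0) \o
      ((fun x => x + x ord0 ord0 *: (s *: a)) \o
       (fun x => x + dot (- t *: a) x *: e0))).
    exact: (preserves_comp p1 (preserves_comp p2 p1)).
  apply/funext => x /=; rewrite /plane_rotation !(dotZl, dotDr, dotZr) ae aa.
  set q := dot a x.
  have -> : (x + (- t * q) *: e0) ord0 ord0 = x ord0 ord0 - t * q.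
    by rewrite !mxE !eqxx/= mulr1 mulNr.
  set x0 := x ord0 ord0; clearbody q x0.
  have -> : (c - 1) * x0 - s * q = - t * q - t * (q + (x0 - t * q) * s).
    have -> : (c - 1) * x0 = - (s * t) * x0 by rewrite st; ring.
    have -> : s * q = t * (1 + c) * q by rewrite tc.
    have -> : t * (1 + c) * q = t * (2 - s * t) * q by rewrite st; ring.
    ring.
  have -> : s * x0 + (c - 1) * q = (x0 - t * q) * s.
    have -> : (c - 1) * q = - (s * t) * q by rewrite st; ring.
    ring.
  by apply/rowP => j; rewrite !mxE; ring.
- move=> x y; rewrite /plane_rotation !(dotDr, dotNr).
  by apply/rowP => j; rewrite !mxE; ring.
- move=> k x; rewrite /plane_rotation !dotZr.
  by apply/rowP => j; rewrite !mxE; ring.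
- move=> x; rewrite !enormE; congr Num.sqrt; rewrite /plane_rotation.
  rewrite !(dotDr, dotDl, dotZl, dotZr) (dotC e0 a) ae aa (dotC e0 x) (dotC x a).
  rewrite !dot_delta e00; set q := dot a x; set x0 := x ord0 ord0.
  clearbody q x0.
  transitivity (dot x x + (c ^+ 2 + s ^+ 2 - 1) * (x0 ^+ 2 + q ^+ 2)).
    by ring.
  by rewrite cs subrr mul0r addr0.
Qed.

(** The rotation in the plane of e0 and of the component of x orthogonal to e0
    does it. The half angle has a tangent unless x = - |x| e0; that point is
    reached by two quarter turns in another plane, and this is where a second
    coordinate is used. *)
Lemma rigid_transitive x : (0 < n)%N ->
  exists2 T, rigid T & T (enorm x *: e0) = x.
Proof.
move=> n0; pose r := enorm x.
have generic y : y != - enorm y *: e0 -> exists2 T, rigid T & T (enorm y *: e0) = y.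
  move=> yr; pose r' := enorm y.
  have r0 : 0 < r'.
    rewrite lt_def enorm_ge0 andbT enorm_eq0; apply: contraNneq yr => ->.
    by rewrite enorm0 oppr0 scale0r.
  pose y' := y - y ord0 ord0 *: e0.
  have y'0 : y' ord0 ord0 = 0 by rewrite !mxE mulr1 subrr.
  have yy : r' ^+ 2 = y ord0 ord0 ^+ 2 + enorm y' ^+ 2.
    rewrite !enorm_sqr !(dotDr, dotDl, dotNr, dotNl, dotZl, dotZr) !(dotC e0 y).
    by rewrite !dot_delta mxE/=; ring.
  have [y'z|y'nz] := eqVneq y' 0.
    exists id; first by split => //; split.
    move: yy (yr); rewrite y'z enorm0 expr0n addr0 -/r' => /eqP.
    have -> : y = y ord0 ord0 *: e0 by apply/eqP; rewrite -subr_eq0 -/y' y'z.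
    rewrite eqf_sqr -/r'; case/orP => /eqP ->.
      by rewrite !mxE mulr1.
    by rewrite !mxE mulr1 opprK eqxx.
  have d0 : 0 < enorm y' by rewrite lt_def enorm_ge0 andbT enorm_eq0.
  pose a := (enorm y')^-1 *: y'.
  have a1 : enorm a = 1.
    by rewrite enormZ ger0_norm ?invr_ge0 ?enorm_ge0// mulVf// gt_eqF.
  have a0 : a ord0 ord0 = 0 by rewrite mxE y'0 mulr0.
  exists (plane_rotation a (y ord0 ord0 / r') (enorm y' / r')).
    apply: rigid_plane_rotation => //.
      by rewrite !expr_div_n -mulrDl -yy divff// expf_neq0// gt_eqF.
    apply: contra_neq y'nz => c1; apply/eqP; rewrite -enorm_eq0 -sqrf_eq0.
    have -> : enorm y' ^+ 2 = r' ^+ 2 - y ord0 ord0 ^+ 2 by rewrite yy; ring.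
    have -> : y ord0 ord0 = - r'.
      have c2 : y ord0 ord0 / r' = -1 by lra.
      by rewrite -[LHS](divfK (lt0r_neq0 r0)) c2 mulN1r.
    by rewrite sqrrN subrr.
  have -> : plane_rotation a (y ord0 ord0 / r') (enorm y' / r') (r' *: e0) =
      y ord0 ord0 *: e0 + enorm y' *: a.
    rewrite /plane_rotation dotZr dot_delta a0 [(r' *: e0) ord0 ord0]mxE mxE eqxx/=.
    by apply/rowP => j; rewrite !mxE; field; rewrite !lt0r_neq0.
  by rewrite /a scalerA divff ?lt0r_neq0// scale1r /y' addrC subrK.
have [xr|/generic//] := eqVneq x (- enorm x *: e0).
pose a := delta_mx ord0 (lift ord0 (Ordinal n0)) : 'rV[R]_n.+1.
have a0 : a ord0 ord0 = 0 by rewrite mxE.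
have aa : dot a a = 1 by rewrite -enorm_sqr enorm_delta expr1n.
pose S := plane_rotation a 0 1.
have rS : rigid S.
  apply: rigid_plane_rotation => //; first exact: enorm_delta.
    by rewrite expr0n expr1n add0r.
exists (S \o S); first exact: rigid_comp.
rewrite [RHS]xr -/r /=.
have -> : S (r *: e0) = r *: a.
  rewrite /S /plane_rotation dotZr dot_delta a0.
  by apply/rowP => j; rewrite !mxE !eqxx/=; ring.
rewrite /S /plane_rotation dotZr aa [(r *: a) ord0 ord0]mxE a0.
by apply/rowP => j; rewrite !mxE; ring.
Qed.

End rotations.

(** * The surface measure of the sphere *)

Lemma mnormalizeE d (T : measurableType d) (R : realType)
    (mu : {measure set T -> \bar R}) (P : probability T R) (A : set T) :
  mu setT != 0%E -> mu setT != +oo%E ->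
  mnormalize mu P A = (mu A * (fine (mu setT))^-1%:E)%E.
Proof. by move=> mu0 muoo; rewrite /mnormalize (negbTE mu0) (negbTE muoo). Qed.

Section surface_measure.
Variables (R : realType) (n : nat).
Local Notation lambda := (lebesgue_rV R n.+1).
Local Notation sigma := (sphere_measure R n.+1).
Local Notation S := (@unit_sphere R n.+1).

Definition box m (a : R) : set 'rV[R]_m :=
  [set x | forall i, x ord0 i \in `[- a, a]].

Lemma measurable_box m a : measurable (@box m a).
Proof.
rewrite (_ : box a = \bigcap_(i in [set: 'I_m])
   (fun y : 'rV[R]_m => y ord0 i) @^-1` `[- a, a]).
  apply: fin_bigcap_measurable => // i _.
  rewrite -[X in measurable X]setTI.
  exact: measurable_coord.
by apply/seteqP; split => y /= h i; [move=> _|]; exact: h.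
Qed.

(** The unit ball contains a box and is contained in one, so that its measure is
    positive and finite and the cone measure can be normalized. *)
Lemma lebesgue_box m (a : R) : 0 < a ->
  lebesgue_rV R m (box a) = ((2 * a) ^+ m)%:E.
Proof.
move=> a0; elim: m => [|m IH].
  rewrite /= expr0 diracE (_ : _ \in _ = true)//.
  by apply/mem_set => -[].
rewrite /= /lebesgue_rV_step /pushforward.
rewrite (_ : _ @^-1` _ = `[- a, a]%classic `*` @box m a); last first.
  apply/seteqP; split => -[t y] /=.
    move=> h; split; first by have := h ord0; rewrite rV_cons0.
    by move=> i; have := h (lift ord0 i); rewrite rV_consS.
  move=> [h1 h2] i; case: (unliftP ord0 i) => [j ->|->].
    by rewrite rV_consS.
  by rewrite rV_cons0.
rewrite product_measure1E//; last exact: measurable_box.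
rewrite [X in (_ * X)%E]IH /= lebesgue_measure_itv/= lte_fin gtrN//.
by rewrite -EFinD -EFinM opprK exprS; congr (_ * _)%:E; ring.
Qed.

Lemma lebesgue_set0 : lambda [set 0] = 0%E.
Proof.
rewrite /= /lebesgue_rV_step /pushforward.
rewrite (_ : _ @^-1` _ = [set 0] `*` box 0); last first.
  apply/seteqP; split => -[t y] /=.
    move=> /rowP h; split; first by have := h ord0; rewrite rV_cons0 mxE.
    move=> i; have := h (lift ord0 i); rewrite rV_consS mxE => ->.
    by rewrite in_itv/= oppr0 lexx.
  move=> [h1 h2]; apply/rowP => i; case: (unliftP ord0 i) => [j ->|->].
    have := h2 j; rewrite rV_consS mxE in_itv/= oppr0 => h.
    by apply/eqP; rewrite eq_le andbC.
  by rewrite rV_cons0 mxE.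
rewrite product_measure1E//; last exact: measurable_box.
by rewrite /= lebesgue_measure_set1 mul0e.
Qed.

Lemma lebesgue_unit_ball_lty : (lambda (@unit_ball R n.+1) < +oo)%E.
Proof.
apply: (@le_lt_trans _ _ (lambda (box 1))).
  apply: le_measure; rewrite ?inE; [exact: measurable_unit_ball|exact: measurable_box|].
  move=> x x1 i; rewrite in_itv/= -ler_norml (le_trans (ler_coord_enorm x i))//.
  exact: ltW.
by rewrite lebesgue_box// ltry.
Qed.

Lemma lebesgue_unit_ball_gt0 : (0 < lambda (@unit_ball R n.+1))%E.
Proof.
pose a : R := n.+2%:R^-1.
have a0 : 0 < a by rewrite invr_gt0.
apply: (@lt_le_trans _ _ (lambda (box a))).
  by rewrite lebesgue_box// lte_fin exprn_gt0// mulr_gt0.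
apply: le_measure; rewrite ?inE; [exact: measurable_box|exact: measurable_unit_ball|].
move=> x xa; rewrite /unit_ball/= -(@ltr_pXn2r _ 2)// ?nnegrE ?enorm_ge0//.
rewrite expr1n enorm_sqr; apply: (@le_lt_trans _ _ (\sum_(i < n.+1) a ^+ 2)).
  apply: ler_sum => i _; rewrite -expr2 -real_normK ?num_real// lerXn2r ?nnegrE ?(ltW a0)//.
  by have := xa i; rewrite in_itv/= ler_norml.
rewrite sumr_const card_ord -mulr_natl expr2 /a mulrA ltr_pdivrMr// mul1r.
by rewrite (@lt_trans _ _ 1)// ?ltr_pdivrMr ?mul1r ?ltr_nat// ltr1n.
Qed.

Lemma sphere_measureE A :
  sigma A = (lambda (@unit_ball R n.+1 `&` @radial_proj R n.+1 @^-1` A)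
             * (fine (lambda (@unit_ball R n.+1)))^-1%:E)%E.
Proof.
have coneT : cone_measure [set: 'rV[R]_n.+1] = lambda (@unit_ball R n.+1).
  by rewrite /cone_measure preimage_setT setIT.
apply: etrans (mnormalizeE _ _ _ _) _ => /=.
- by rewrite [X in X != _]coneT gt_eqF ?lebesgue_unit_ball_gt0.
- by rewrite [X in X != _]coneT lt_eqF ?lebesgue_unit_ball_lty.
- by congr (_ * (fine _)^-1%:E)%E.
Qed.

Lemma measurable_unit_sphere : measurable S.
Proof.
rewrite (_ : S = @enorm R n.+1 @^-1` [set 1])//.
rewrite -[X in measurable X]setTI; exact: measurable_enorm.
Qed.

(** The cone over the sphere is the ball without the origin. *)
Lemma sphere_measure_sphere : sigma S = 1%E.
Proof.
rewrite -(@probability_setT _ _ _ sigma) !sphere_measureE; congr (_ * _)%E.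
rewrite preimage_setT setIT.
have BE : @unit_ball R n.+1 `&` @radial_proj R n.+1 @^-1` S =
    @unit_ball R n.+1 `\` [set 0].
  apply/seteqP; split => x /= [x1 h]; split => //.
    move=> x0; move: h; rewrite x0 /radial_proj scaler0 /unit_sphere/= enorm0.
    by move/eqP; rewrite eq_sym oner_eq0.
  have xp : enorm x != 0 by rewrite enorm_eq0; exact/eqP.
  by rewrite /radial_proj /unit_sphere/= enormZ ger0_norm ?invr_ge0 ?enorm_ge0// mulVf.
rewrite BE measureD//=; first last.
- exact: lebesgue_unit_ball_lty.
- rewrite (_ : [set 0] = @enorm R n.+1 @^-1` [set 0]).
    by rewrite -[X in measurable X]setTI; exact: measurable_enorm.
  by apply/seteqP; split => x /=; [move=> ->; rewrite enorm0|move/eqP; rewrite enorm_eq0 => /eqP].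
- exact: measurable_unit_ball.
rewrite (_ : _ `&` _ = [set 0]); first by rewrite [X in (_ - X)%E]lebesgue_set0 sube0.
by apply/seteqP; split => [x []//|_ ->]; split => //=; rewrite /unit_ball/= enorm0.
Qed.

Lemma radial_proj_rigid (T : 'rV[R]_n.+1 -> 'rV[R]_n.+1) x : rigid T ->
  radial_proj (T x) = T (radial_proj x).
Proof. by move=> rT; rewrite /radial_proj (rigid_enorm rT) (rigidZ rT). Qed.

(** A rigid map preserves the ball and commutes with the radial projection, so
    that it maps the cone over a set to the cone over its image. *)
Lemma sphere_measure_rigid (T : 'rV[R]_n.+1 -> 'rV[R]_n.+1) : rigid T ->
  preserves sigma T.
Proof.
move=> rT; have [mT pT] := rigid_preserves rT.
split => // A mA; rewrite !sphere_measureE; congr (_ * _)%E.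
rewrite -[RHS]pT; last first.
  apply: measurableI; first exact: measurable_unit_ball.
  by rewrite -[X in measurable X]setTI; exact: measurable_radial_proj.
congr (lambda _); apply/seteqP; split => x /=;
  by rewrite /unit_ball/= (rigid_enorm rT) radial_proj_rigid.
Qed.

Lemma sphere_integral_rigid (T : 'rV[R]_n.+1 -> 'rV[R]_n.+1) (F : 'rV[R]_n.+1 -> R) :
  rigid T -> measurable_fun S F -> (forall z, S z -> 0 <= F z) ->
  \int[sigma]_(z in S) F (T z) = \int[sigma]_(z in S) F z.
Proof.
move=> rT mF F0; rewrite /Rintegral; congr fine.
have [mT pT] := sphere_measure_rigid rT.
transitivity (\int[pushforward sigma T]_(z in S) (F z)%:E)%E.
  rewrite ge0_integral_pushforward//.
  - congr (integral _ _ _); apply/seteqP; split => z /=;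
    by rewrite /unit_sphere/= (rigid_enorm rT).
  - exact: measurable_unit_sphere.
  - exact/measurable_EFinP.
  - by move=> z /set_mem zS; rewrite lee_fin F0.
by apply: eq_measure_integral => A mA _; exact: pT.
Qed.

End surface_measure.

(** * The maximum principle *)

Section second_derivative_test.
Variable R : realType.

(** If a > 0 then phi1, which vanishes at 0, is positive just to the right of 0,
    and phi increases there. *)
Lemma second_derivative_local_max (phi phi1 : R -> R) (a d : R) : 0 < d ->
  (forall t : R, `|t| < d -> is_derive t (1 : R) phi (phi1 t)) ->
  is_derive (0 : R) 1 phi1 a -> (forall t, `|t| < d -> phi t <= phi 0) -> a <= 0.
Proof.
move=> d0 dphi [dphi1 phi1a] phimax; rewrite leNgt; apply/negP => a0.
have inI t : t \in `]- d, d[ -> `|t| < d by rewrite in_itv/= ltr_norml.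
have d00 : 0 \in `]- d, d[ by rewrite in_itv/= oppr_lt0 d0.
have phi10 : phi1 0 = 0.
  have [_ <-] : is_derive (0 : R) 1 phi (phi1 0) by apply: dphi; rewrite normr0.
  have dd : - d <= d by rewrite ge0_cp// ltW.
  have dder t : t \in `]- d, d[ -> derivable phi t 1.
    by move=> /inI td; have [] := dphi t td.
  by have [] := derive1_at_max dd dder d00 (fun t tI => phimax t (inI t tI)).
have {dphi1 phi1a} cv : (fun h => h^-1 * phi1 h) @ 0^' --> a.
  rewrite -phi1a /derive; move: dphi1; rewrite /derivable.
  rewrite (_ : (fun h => _) = (fun h => h^-1 * phi1 h)) => [//|].
  by apply/funext => h /=; rewrite phi10 subr0 [_%:A]mulr1 addr0.
have := cvgr_gt _ cv _ a0; rewrite near_withinE => -[/= e e0 he].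
pose t := Num.min d e / 2.
have t0 : 0 < t by rewrite divr_gt0// lt_min d0.
have td : t < d by rewrite ltr_pdivrMr// gt_min ltr_pMr ?ltr1n.
have te : t < e by rewrite ltr_pdivrMr// gt_min [X in _ || X]ltr_pMr ?ltr1n ?orbT.
have bd s : 0 <= s <= t -> `|s| < d.
  by case/andP => s0 st; rewrite ger0_norm// (le_lt_trans st).
have [||c] := @MVT _ phi phi1 0 t t0.
- by move=> s; rewrite in_itv/= => /andP[s0 st]; apply: dphi; rewrite bd// !ltW.
- apply: derivable_within_continuous => s; rewrite in_itv/= => st.
  by have [] := dphi s (bd s st).
rewrite in_itv/= => /andP[c0 ct]; rewrite subr0 => E.
have : phi t - phi 0 <= 0 by rewrite subr_le0 phimax// bd// lexx ltW.
rewrite E leNgt => /negP; apply; rewrite mulr_gt0//.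
have := he c; rewrite /ball/= sub0r normrN gtr0_norm// => /(_ (lt_trans ct te) (lt0r_neq0 c0)).
by rewrite pmulr_rgt0 ?invr_gt0.
Qed.

End second_derivative_test.

Section maximum_principle.
Variables (R : realType) (n : nat).
Notation V := 'rV[R]_n.+1.
Notation e_ k := (delta_mx ord0 k : V).

(** Reduction to one variable: the two difference quotients coincide. *)
Lemma derive_line (h : V -> R) (x v : V) (t : R) (d : R) :
  is_derive (x + t *: v) v h d <-> is_derive t 1 (fun s => h (x + s *: v)) d.
Proof.
have E : (fun s => s^-1 *: ((h \o shift (x + t *: v)) (s *: v) - h (x + t *: v))) =
  (fun s => s^-1 *: (((fun s => h (x + s *: v)) \o shift t) (s *: 1) - h (x + t *: v))).
  apply/funext => s /=; congr (_ *: (h _ - _)).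
  by rewrite [_%:A]mulr1 scalerDl addrCA.
by split => -[d1 d2]; split; rewrite /derivable /derive in d1 d2 *;
  rewrite ?E// -?E.
Qed.

(** The derivatives are given rather than computed because those of an integral
    with a parameter come as integrals of other kernels. Only pure second
    derivatives enter the Laplacian. *)
Definition second_partials (U : set V) (h : V -> R) (h1 h2 : 'I_n.+1 -> V -> R) :=
  forall x, U x -> forall k,
    is_derive x (e_ k) h (h1 k x) /\ is_derive x (e_ k) (h1 k) (h2 k x).

Lemma second_partialsD U h h1 h2 g g1 g2 (c : R) :
  second_partials U h h1 h2 -> second_partials U g g1 g2 ->
  second_partials U (fun x => h x + c * g x)
    (fun k x => h1 k x + c * g1 k x) (fun k x => h2 k x + c * g2 k x).
Proof.
move=> H G x Ux k; have [h1d h2d] := H x Ux k; have [g1d g2d] := G x Ux k.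
split.
  exact: (is_deriveD h1d (is_deriveZ c g1d)).
exact: (is_deriveD h2d (is_deriveZ c g2d)).
Qed.

Lemma second_partials_sum U m (h : 'I_m -> V -> R) h1 h2 (c : 'I_m -> R) :
  (forall j, second_partials U (h j) (h1 j) (h2 j)) ->
  second_partials U (fun x => \sum_j c j * h j x)
    (fun k x => \sum_j c j * h1 j k x) (fun k x => \sum_j c j * h2 j k x).
Proof.
move=> H x Ux k; split.
  rewrite (_ : (fun x => _) = \sum_j (fun x => c j * h j x)); last first.
    by apply/funext => y; rewrite fct_sumE.
  by apply: is_derive_sum => j; have [hd _] := H j x Ux k; exact: (is_deriveZ (c j) hd).
rewrite (_ : (fun x => _) = \sum_j (fun x => c j * h1 j k x)); last first.
  by apply/funext => y; rewrite fct_sumE.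
by apply: is_derive_sum => j; have [_ hd] := H j x Ux k; exact: (is_deriveZ (c j) hd).
Qed.

Lemma is_derive_coordE (x : V) (i j : 'I_n.+1) :
  is_derive x (e_ j) (fun y => y ord0 i) (i == j)%:R.
Proof.
rewrite -[x](addr0 x) -(scale0r (e_ j)); apply/derive_line.
rewrite (_ : (fun s => _) = (cst (x ord0 i) + (i == j)%:R \*: id)).
  have d := is_deriveZ (i == j)%:R (is_derive_id (0 : R) 1).
  have := is_deriveD (is_derive_cst (x ord0 i) _ _) d.
  by rewrite add0r [_%:A]mulr1.
by apply/funext => s; rewrite !mxE eqxx/= mulrC.
Qed.

Lemma is_derive_coord (x : V) (k : 'I_n.+1) :
  is_derive x (e_ k) (fun y => y ord0 k) 1.
Proof. by have := is_derive_coordE x k k; rewrite eqxx. Qed.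

Lemma is_derive_enorm_sqr (x z : V) (k : 'I_n.+1) :
  is_derive x (e_ k) (fun y => enorm (y - z) ^+ 2) (2 * (x - z) ord0 k).
Proof.
rewrite -{1}[x](addr0 x) -(scale0r (e_ k)); apply/derive_line.
set b := (x - z) ord0 k.
have d1 := is_deriveZ (2 * b) (is_derive_id (0 : R) 1).
have d2 := is_deriveX 2 (is_derive_id (0 : R) 1).
have d3 := is_deriveD (is_deriveD (is_derive_cst (enorm (x - z) ^+ 2) _ _) d1) d2.
rewrite (_ : (fun s => _) =
    cst (enorm (x - z) ^+ 2) + (2 * b) \*: (id : R -> R) + id ^+ 2).
  apply: (is_derive_eq d3).
  by rewrite expr1 mulr0 scale0r addr0 add0r [_%:A]mulr1.
by apply/funext => s; rewrite addrAC enorm_line.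
Qed.

Lemma second_partials_enorm_sqr U :
  second_partials U (fun x => enorm x ^+ 2) (fun k x => 2 * x ord0 k) (fun _ _ => 2).
Proof.
move=> x _ k; split.
  have := is_derive_enorm_sqr x 0 k; rewrite subr0.
  by under eq_fun do rewrite subr0.
have := is_deriveZ 2 (is_derive_coord x k).
by rewrite [_%:A]mulr1.
Qed.

(** Adding eps |x|^2 makes the Laplacian positive, which is impossible at an
    interior maximum. *)
Lemma maximum_principle (r C : R) (v : V -> R) v1 v2 :
  second_partials [set x | enorm x < r] v v1 v2 ->
  {within [set x | enorm x <= r], continuous v} ->
  (forall x, enorm x < r -> 0 <= \sum_k v2 k x) ->
  (forall x, enorm x = r -> v x <= C) ->
  forall x, enorm x <= r -> v x <= C.
Proof.
move=> dv cv lv bv x xr.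
have r0 : 0 <= r by apply: le_trans xr; exact: enorm_ge0.
apply/ler_addgt0Pr => e e0.
have [e' e'0 e'r] : exists2 e', 0 < e' & e' * r ^+ 2 <= e.
  exists (e / (r ^+ 2 + 1)); first by rewrite divr_gt0// ltr_wpDl ?sqr_ge0.
  rewrite mulrAC ler_pdivrMr ?ltr_wpDl ?sqr_ge0//.
  by rewrite ler_wpM2l ?(ltW e0)// lerDl.
pose w y := v y + e' * enorm y ^+ 2.
have cw : {within [set x | enorm x <= r], continuous w}.
  apply: within_continuousD => //; apply: continuous_subspaceT => y.
  apply: (continuousM (s := cst e') (t := fun y => enorm y ^+ 2)).
    exact: cst_continuous.
  exact: continuous_enorm_sqr.
have x0 : [set x : V | enorm x <= r] !=set0 by exists x.
have [c /set_mem/= cr cmax] := EVT_max_rV x0 (@closed_ball_compact R n.+1 r) cw.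
have {}cmax y : enorm y <= r -> w y <= w c by move=> yr; apply: cmax; rewrite inE.
have dw := second_partialsD e' dv (@second_partials_enorm_sqr [set x | enorm x < r]).
move: cr; rewrite le_eqVlt => /predU1P[rc|cr].
  apply: (@le_trans _ _ (w x)); first by rewrite lerDl mulr_ge0 ?sqr_ge0// ltW.
  apply: (le_trans (cmax x xr)).
  by apply: lerD; [exact: bv|rewrite rc].
exfalso.
pose d := r - enorm c.
have inr k t : `|t| < d -> enorm (c + t *: e_ k) < r.
  move=> td; apply: (le_lt_trans (ler_enormD _ _)).
  by rewrite enormZ enorm_delta mulr1 -ltrBrDl.
have w2 k : v2 k c + e' * 2 <= 0.
  apply: (@second_derivative_local_max _ (fun t => w (c + t *: e_ k))
     (fun t => v1 k (c + t *: e_ k) + e' * (2 * (c + t *: e_ k) ord0 k)) _ d).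
  - by rewrite subr_gt0.
  - by move=> t td; apply/derive_line; have [] := dw _ (inr k t td) k.
  - apply/(derive_line (fun x => v1 k x + e' * (2 * x ord0 k))).
    by rewrite scale0r addr0; have [] := dw c cr k.
  - by move=> t td; rewrite scale0r addr0 cmax// ltW// inr.
have : \sum_k (v2 k c + e' * 2) <= 0 by apply: sumr_le0 => k _; exact: w2.
rewrite big_split/= sumr_const card_ord leNgt => /negP; apply.
by rewrite ltr_wpDl ?lv// pmulrn_lgt0// mulr_gt0.
Qed.

End maximum_principle.

(** * Integrals over the sphere depending on a parameter *)

Section sphere_kernels.
Variables (R : realType) (n : nat).
Notation V := 'rV[R]_n.+1.
Notation e_ k := (delta_mx ord0 k : V).
Local Notation sigma := (sphere_measure R n.+1).
Local Notation S := (@unit_sphere R n.+1).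
Implicit Types (K : V -> V -> R) (f : V -> R).

(** Joint continuity on the open ball times the sphere: by compactness of the
    sphere it gives at once integrability over the sphere and the local uniform
    bounds under which integrals may be differentiated. *)
Definition jcont K := forall x z, enorm x < 1 -> S z ->
  {for (x, z), continuous (fun p : V * V => K p.1 p.2)}.

(** Compactness of the sphere makes the continuity in x uniform in z. *)
Lemma jcont_near K x0 (e : R) : jcont K -> enorm x0 < 1 -> 0 < e ->
  \forall x \near x0, forall z, S z -> `|K x z - K x0 z| < e.
Proof.
move=> cK x01 e0.
have := (compact_near_coveringP S).1 (@sphere_compact R n.+1 1) V (nbhs x0)
  (fun x z => `|K x z - K x0 z| < e) _; apply.
move=> z Sz; have e20 : 0 < e / 2 by rewrite divr_gt0.
have /cvgrPdist_lt/(_ _ e20)[[U W] /= [nU nW] UW] := cK x0 z x01 Sz.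
exists (W, U) => //= -[z' x] /= [Wz' Ux].
have h1 := UW (x, z') (conj Ux Wz').
have h2 := UW (x0, z') (conj (nbhs_singleton nU) Wz').
rewrite /= in h1 h2.
have -> : K x z' - K x0 z' = (K x0 z - K x0 z') - (K x0 z - K x z') by ring.
by rewrite (le_lt_trans (ler_normB _ _))// (splitr e) ltrD.
Qed.

Lemma jcont_within K x : jcont K -> enorm x < 1 -> {within S, continuous (K x)}.
Proof.
move=> cK x1; apply: continuous_in_subspaceT => z /set_mem Sz.
apply: (@continuous_comp _ _ _ (fun z => (x, z)) (fun p : V * V => K p.1 p.2)).
  exact: (@cvg_pair V V V (nbhs z) (nbhs x) (nbhs z) _ _ _ (fun=> x) id
    (cvg_cst x) cvg_id).
exact: cK.
Qed.

Lemma compact_within_bounded (A : set V) f : compact A ->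
  {within A, continuous f} -> exists2 B, 0 <= B & forall z, A z -> `|f z| <= B.
Proof.
move=> cA cf; have := compact_bounded (continuous_compact cf cA).
move=> [M [_ /(_ (`|M| + 1))]]; rewrite (le_lt_trans (ler_norm M)) ?ltrDl// => /(_ isT) h.
exists (`|M| + 1) => [|z Az]; first by rewrite addr_ge0.
by apply: h; exists z.
Qed.

Lemma within_sphere_bounded f : {within S, continuous f} ->
  exists2 B, 0 <= B & forall z, S z -> `|f z| <= B.
Proof. exact/compact_within_bounded/sphere_compact. Qed.

Lemma jcont_bounded K x0 : jcont K -> enorm x0 < 1 ->
  exists C, \forall x \near x0, forall z, S z -> `|K x z| <= C.
Proof.
move=> cK x01; have [B B0 hB] := within_sphere_bounded (jcont_within cK x01).
exists (1 + B); near=> x => z Sz.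
rewrite -(subrK (K x0 z) (K x z)) (le_trans (ler_normD _ _))// lerD ?hB//.
by apply/ltW; move: z Sz; near: x; exact: jcont_near.
Unshelve. all: by end_near. Qed.

Definition bounded_measurable f :=
  measurable_fun S f /\ exists2 B, 0 <= B & forall z, S z -> `|f z| <= B.

Lemma bounded_measurable_integrable f :
  bounded_measurable f -> sigma.-integrable S (EFin \o f).
Proof.
move=> [mf [B B0 hB]]; apply: measurable_bounded_integrable => //.
- exact: measurable_unit_sphere.
- by rewrite [X in (X < _)%E]sphere_measure_sphere ltry.
- exists B; split; first exact: num_real.
  by move=> M BM z Sz; exact: (le_trans (hB z Sz) (ltW BM)).
Qed.

Lemma bounded_measurableM f g :
  bounded_measurable f -> bounded_measurable g ->
  bounded_measurable (fun z => f z * g z).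
Proof.
move=> [mf [A A0 hA]] [mg [B B0 hB]]; split; first exact: measurable_funM.
exists (A * B) => [|z Sz]; first exact: mulr_ge0.
by rewrite normrM ler_pM ?hA ?hB.
Qed.

Lemma within_bounded_measurable f :
  {within S, continuous f} -> bounded_measurable f.
Proof.
move=> cf; split; last exact: within_sphere_bounded.
by apply: continuous_within_measurable => //; exact: measurable_unit_sphere.
Qed.

Lemma jcont_bounded_measurable K x f : jcont K -> enorm x < 1 ->
  bounded_measurable f -> bounded_measurable (fun z => K x z * f z).
Proof.
move=> cK x1 bf; apply: bounded_measurableM => //.
exact/within_bounded_measurable/jcont_within.
Qed.

Definition kernel_integral K f (x : V) : R :=
  \int[sigma]_(z in S) (K x z * f z).

Lemma Rintegral_sphere_cst (c : R) : \int[sigma]_(z in S) c = c.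
Proof.
rewrite Rintegral_cst; last exact: measurable_unit_sphere.
by rewrite [X in fine X]sphere_measure_sphere mulr1.
Qed.

Lemma ler_sphere_integral f (C : R) : bounded_measurable f ->
  (forall z, S z -> `|f z| <= C) -> `|\int[sigma]_(z in S) f z| <= C.
Proof.
move=> bf fC; apply: (le_trans (le_normr_Rintegral _ _)).
- exact: measurable_unit_sphere.
- exact: bounded_measurable_integrable.
rewrite -[leRHS]Rintegral_sphere_cst; apply: le_Rintegral => //.
- exact: measurable_unit_sphere.
- apply: (bounded_measurable_integrable (f := fun z => `|f z|)).
  have [mf [B B0 hB]] := bf; split; last by exists B => // z Sz; rewrite normr_id hB.
  exact: (measurableT_comp (@normr_measurable _ setT)).
- apply: bounded_measurable_integrable; split; first exact: measurable_cst.
  by exists `|C|.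
Qed.

Lemma kernel_integral_continuous K f x0 : jcont K -> bounded_measurable f ->
  enorm x0 < 1 -> {for x0, continuous (kernel_integral K f)}.
Proof.
move=> cK bf x01; have [mf [B B0 hB]] := bf.
apply/(cvgrPdist_le (F := nbhs x0)) => e e0.
have eB0 : 0 < e / (B + 1) by rewrite divr_gt0// ltr_wpDl.
near=> x.
have x1 : enorm x < 1.
  by near: x; exact: (open_nbhs_nbhs (conj (@open_ball_open R n.+1 1) x01)).
have b0 := jcont_bounded_measurable cK x01 bf.
have b1 := jcont_bounded_measurable cK x1 bf.
rewrite distrC /kernel_integral -RintegralB; first last.
- exact: bounded_measurable_integrable.
- exact: bounded_measurable_integrable.
- exact: measurable_unit_sphere.
apply: ler_sphere_integral => [|z Sz].
  have [m0 [B1 B10 h0]] := b0; have [m1 [B2 B20 h1]] := b1.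
  split; first exact: measurable_funB.
  exists (B2 + B1) => [|z Sz]; first exact: addr_ge0.
  by rewrite (le_trans (ler_normB _ _))// lerD ?h0 ?h1.
rewrite -mulrBl normrM.
apply: (@le_trans _ _ (e / (B + 1) * B)).
  apply: ler_pM => //; last exact: hB.
  by apply/ltW; move: z Sz; near: x; exact: jcont_near.
by rewrite mulrAC ler_pdivrMr ?ltr_wpDl// ler_pM2l// lerDl.
Unshelve. all: by end_near. Qed.

(** K' is bounded near x0 uniformly over the sphere, so that difference quotients
    along e_k are dominated by a constant. *)
Lemma kernel_integral_derive K K' f (k : 'I_n.+1) x0 :
  jcont K -> jcont K' -> bounded_measurable f ->
  (forall x z, enorm x < 1 -> S z -> is_derive x (e_ k) (K ^~ z) (K' x z)) ->
  enorm x0 < 1 ->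
  is_derive x0 (e_ k) (kernel_integral K f) (kernel_integral K' f x0).
Proof.
move=> cK cK' bf dK x01; have [mf [B B0 hB]] := bf.
have [C hC] := jcont_bounded cK' x01.
pose l t : V := x0 + t *: e_ k.
have cl : {for 0, continuous l}.
  move=> ?; apply: cvgD; first exact: cvg_cst.
  by apply: cvgZr_tmp; exact: cvg_id.
have near_x0 : nbhs (l 0)
    [set x | enorm x < 1 /\ forall z, S z -> `|K' x z| <= C].
  rewrite /l scale0r addr0; near=> x; split.
    by near: x; exact: (open_nbhs_nbhs (conj (@open_ball_open R n.+1 1) x01)).
  by near: x.
have [d /= d0 hd] := cl _ near_x0.
have inl t : `]- d, d[%classic t -> enorm (l t) < 1 /\
    forall z, S z -> `|K' (l t) z| <= C.
  by rewrite /= in_itv/= -ltr_norml => td; apply: hd; rewrite /= sub0r normrN.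
pose F t z := K (l t) z * f z.
have dF t z : `]- d, d[%classic t -> S z -> is_derive t (1 : R) (F ^~ z) (K' (l t) z * f z).
  move=> td Sz; have := dK (l t) z (inl t td).1 Sz.
  move=> /derive_line/(is_deriveZ (f z)) h.
  rewrite mulrC; rewrite (_ : F ^~ z = f z \*: (fun s => K (x0 + s *: e_ k) z))//.
  by apply/funext => s; rewrite /F /= mulrC.
have i0 : `]- d, d[%classic (0 : R) by rewrite /= in_itv/= oppr_lt0 d0.
have intF t : `]- d, d[%classic t -> sigma.-integrable S (EFin \o F t).
  move=> td; apply: bounded_measurable_integrable.
  exact: (jcont_bounded_measurable cK (inl t td).1 bf).
have derF t z : `]- d, d[%classic t -> S z -> derivable (F ^~ z) t 1.
  by move=> td Sz; have [] := dF t z td Sz.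
have G0 : forall y : V, 0 <= `|C| * B by move=> _; rewrite mulr_ge0.
have intG : sigma.-integrable S (EFin \o (fun y : V => `|C| * B)).
  apply: bounded_measurable_integrable; split; first exact: measurable_cst.
  by exists (`|C| * B) => [|z _]; [exact: mulr_ge0|rewrite ger0_norm// mulr_ge0].
have d1F t z : `]- d, d[%classic t -> S z -> partial1of2 F t z = K' (l t) z * f z.
  by move=> td Sz; rewrite partial1of2E; have [_ ->] := dF t z td Sz.
have Gub t z : `]- d, d[%classic t -> S z -> `|partial1of2 F t z| <= `|C| * B.
  move=> td Sz; rewrite d1F// normrM ler_pM ?hB//.
  by rewrite (le_trans ((inl t td).2 z Sz)) ?ler_norm.
have mS := @measurable_unit_sphere R n.
have D1 := derivable_under_integral mS i0 intF derF G0 intG Gub.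
have D2 := differentiation_under_integral mS i0 intF derF G0 intG Gub.
rewrite -[x0]addr0 -(scale0r (e_ k)); apply/derive_line.
apply: DeriveDef; first exact: D1.
rewrite -derive1E scale0r addr0 [LHS]D2; apply: eq_Rintegral => z /set_mem Sz.
have /= := d1F 0 z i0 Sz; rewrite /partial1of2 => ->.
by rewrite /l scale0r addr0.
Unshelve. all: by end_near. Qed.

End sphere_kernels.

(** * The Poisson kernel is harmonic *)

Section poisson_kernel_derivatives.
Variables (R : realType) (n : nat).
Notation V := 'rV[R]_n.+1.
Notation e_ k := (delta_mx ord0 k : V).
Local Notation sigma := (sphere_measure R n.+1).
Local Notation S := (@unit_sphere R n.+1).
Implicit Types (K L : V -> V -> R) (f : V -> R) (x z : V).

Lemma enorm_sub_gt0 x z : enorm x < 1 -> S z -> 0 < enorm (x - z).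
Proof.
move=> x1 z1; rewrite enormB (lt_le_trans _ (ler_enormB _ _))// z1 subr_gt0//.
Qed.

Lemma jcont_cst (c : R) : jcont (fun _ _ : V => c).
Proof. by move=> x z _ _; exact: cst_continuous. Qed.

Lemma jcontD K L : jcont K -> jcont L -> jcont (fun x z => K x z + L x z).
Proof.
by move=> cK cL x z x1 z1; apply: continuousD; [exact: cK|exact: cL].
Qed.

Lemma jcontN K : jcont K -> jcont (fun x z => - K x z).
Proof. by move=> cK x z x1 z1; apply: continuousN; exact: cK. Qed.

Lemma jcontM K L : jcont K -> jcont L -> jcont (fun x z => K x z * L x z).
Proof.
by move=> cK cL x z x1 z1; apply: continuousM; [exact: cK|exact: cL].
Qed.

Lemma jcontX K m : jcont K -> jcont (fun x z => K x z ^+ m).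
Proof.
move=> cK; elim: m => [|m IH].
  by rewrite (_ : (fun _ _ => _) = fun _ _ => 1)//; exact: jcont_cst.
rewrite (_ : (fun _ _ => _) = fun x z => K x z * K x z ^+ m).
  exact: jcontM.
by apply/funext => x; apply/funext => z; rewrite exprS.
Qed.

Lemma jcont_fst (h : V -> R) : continuous h -> jcont (fun x _ => h x).
Proof.
move=> ch x z _ _; apply: (@continuous_comp _ _ _ (@fst V V) h).
  exact: cvg_fst.
exact: ch.
Qed.

Lemma jcont_snd (h : V -> R) : continuous h -> jcont (fun _ z => h z).
Proof.
move=> ch x z _ _; apply: (@continuous_comp _ _ _ (@snd V V) h).
  exact: cvg_snd.
exact: ch.
Qed.

Lemma jcont_coord k : jcont (fun x _ => x ord0 k).
Proof. by apply: jcont_fst => x; exact: coord_continuous. Qed.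

Lemma jcont_sub k : jcont (fun x z => (x - z) ord0 k).
Proof.
rewrite (_ : (fun _ _ => _) = fun x z => x ord0 k + -1 * z ord0 k).
  apply: jcontD; first exact: jcont_coord.
  apply: jcontM; first exact: jcont_cst.
  by apply: jcont_snd => x; exact: coord_continuous.
by apply/funext => x; apply/funext => z; rewrite !mxE mulN1r.
Qed.

(** The gradient of 1 / |x - z| in x is - (x - z) / |x - z|^3. Hence, written with
    this function, the Poisson kernel and its derivatives are polynomials in
    1 / |x - z| and the coordinates. *)
Definition inv_dist x z : R := (enorm (x - z))^-1.

Lemma jcont_inv_dist : jcont inv_dist.
Proof.
move=> x z x1 z1; apply: continuousV; first by rewrite gt_eqF// enorm_sub_gt0.
apply: (@continuous_comp _ _ _ (fun p : V * V => p.1 - p.2) (@enorm R n.+1)).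
  by apply: continuousB; [exact: cvg_fst|exact: cvg_snd].
exact: continuous_enorm.
Qed.

Lemma is_derive_inv_dist x z k : enorm x < 1 -> S z ->
  is_derive x (e_ k) (inv_dist ^~ z) (- (x - z) ord0 k * inv_dist x z ^+ 3).
Proof.
move=> x1 z1; have d0 := enorm_sub_gt0 x1 z1.
pose q s := enorm (x + s *: e_ k - z) ^+ 2.
have dq : is_derive (0 : R) 1 q (2 * (x - z) ord0 k).
  have := is_derive_enorm_sqr x z k; rewrite -{1}[x]addr0 -(scale0r (e_ k)).
  by move/derive_line.
have q0 : q 0 = enorm (x - z) ^+ 2 by rewrite /q scale0r addr0.
have sq : Num.sqrt (q 0) = enorm (x - z) by rewrite q0 sqrtr_sqr ger0_norm ?enorm_ge0.
have ds : is_derive (q 0) 1 Num.sqrt (2 * Num.sqrt (q 0))^-1.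
  by apply: is_derive1_sqrt; rewrite q0 exprn_gt0.
have dr := is_derive1_comp ds dq.
rewrite -{1}[x]addr0 -(scale0r (e_ k)); apply/derive_line.
rewrite (_ : (fun s => _) = fun s => ((Num.sqrt \o q) s)^-1); last first.
  by apply/funext => s; rewrite /= /q sqrtr_sqr ger0_norm ?enorm_ge0.
have nz : (Num.sqrt \o q) 0 != 0 by rewrite /= sq gt_eqF.
have [dr1 dr2] := dr.
apply: DeriveDef; first exact: (derivableV nz dr1).
rewrite (deriveV nz dr1) dr2 /= sq /inv_dist.
rewrite -[_ *: _]/(_ * _); field.
by rewrite gt_eqF.
Qed.

Lemma is_derive_inv_distX x z k m : enorm x < 1 -> S z ->
  is_derive x (e_ k) (fun y => inv_dist y z ^+ m.+1)
    (- m.+1%:R * (x - z) ord0 k * inv_dist x z ^+ m.+3).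
Proof.
move=> x1 z1.
rewrite (_ : (fun y => _) = (inv_dist ^~ z) ^+ m.+1); last first.
  by apply/funext => y; rewrite exprfctE.
have := is_deriveX m.+1 (is_derive_inv_dist k x1 z1).
move=> /is_derive_eq; apply; rewrite -[_ *: _]/(_ * _)/= !exprS.
ring.
Qed.

Lemma is_derive_sub x z k :
  is_derive x (e_ k) (fun y => (y - z) ord0 k) 1.
Proof.
have := is_deriveD (is_derive_coord x k) (is_derive_cst (- z ord0 k) x (e_ k)).
rewrite addr0; rewrite (_ : _ + _ = fun y => (y - z) ord0 k)//.
by apply/funext => y; rewrite !mxE.
Qed.

Definition poisson_kernel_partial (k : 'I_n.+1) x z : R :=
  -2 * x ord0 k * inv_dist x z ^+ n.+1
  - n.+1%:R * ((1 - enorm x ^+ 2) * (x - z) ord0 k) * inv_dist x z ^+ n.+3.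

Definition poisson_kernel_partial2 (k : 'I_n.+1) x z : R :=
  -2 * inv_dist x z ^+ n.+1
  + 4 * n.+1%:R * (x ord0 k * (x - z) ord0 k) * inv_dist x z ^+ n.+3
  - n.+1%:R * (1 - enorm x ^+ 2) * inv_dist x z ^+ n.+3
  + n.+1%:R * n.+3%:R * (1 - enorm x ^+ 2) * ((x - z) ord0 k) ^+ 2
    * inv_dist x z ^+ n.+4.+1.

Lemma poisson_kernelE x z :
  poisson_kernel x z = (1 - enorm x ^+ 2) * inv_dist x z ^+ n.+1.
Proof. by rewrite /poisson_kernel /inv_dist exprVn. Qed.

Lemma is_derive_1Benorm x k :
  is_derive x (e_ k) (fun y => 1 - enorm y ^+ 2) (- 2 * x ord0 k).
Proof.
have [d _] := @second_partials_enorm_sqr R n setT x I k.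
have := is_deriveB (is_derive_cst (1 : R) x (e_ k)) d.
by rewrite sub0r mulNr.
Qed.

Lemma is_derive_poisson_kernel x z k : enorm x < 1 -> S z ->
  is_derive x (e_ k) ((@poisson_kernel R n.+1) ^~ z) (poisson_kernel_partial k x z).
Proof.
move=> x1 z1.
rewrite (_ : (@poisson_kernel R n.+1) ^~ z =
    fun y => (1 - enorm y ^+ 2) * inv_dist y z ^+ n.+1); last first.
  by apply/funext => y; rewrite poisson_kernelE.
have := is_deriveM (is_derive_1Benorm x k) (is_derive_inv_distX k n x1 z1).
move=> /is_derive_eq; apply; rewrite /poisson_kernel_partial -![_ *: _]/(_ * _).
ring.
Qed.

Lemma is_derive_poisson_kernel_partial x z k : enorm x < 1 -> S z ->
  is_derive x (e_ k) ((poisson_kernel_partial k) ^~ z) (poisson_kernel_partial2 k x z).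
Proof.
move=> x1 z1.
have dx := is_deriveZ (-2) (is_derive_coord x k).
have d1 := is_deriveM dx (is_derive_inv_distX k n x1 z1).
have d2 := is_deriveM (is_derive_1Benorm x k) (is_derive_sub x z k).
have d3 := is_deriveM (is_deriveZ n.+1%:R d2) (is_derive_inv_distX k n.+2 x1 z1).
have := is_deriveB d1 d3.
move=> /is_derive_eq; apply; rewrite /poisson_kernel_partial2.
rewrite -![_ *: _]/(_ * _) !fctE /=.
rewrite -![_ *: _]/(_ * _).
ring.
Qed.

(** For N the dimension, the sum is 2 N |x - z|^(-N-2) times
    1 - |x|^2 + 2 x . (x - z) - |x - z|^2, which is 1 - |z|^2 = 0. *)
Lemma poisson_kernel_laplacian x z : enorm x < 1 -> S z ->
  \sum_k poisson_kernel_partial2 k x z = 0.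
Proof.
move=> x1 z1; have d0 := enorm_sub_gt0 x1 z1.
rewrite /poisson_kernel_partial2 !big_split/= -!mulr_suml -!mulr_sumr !sumr_const card_ord.
have -> : \sum_k x ord0 k * (x - z) ord0 k = dot x (x - z) by [].
have -> : \sum_(k < n.+1) (x - z) ord0 k ^+ 2 = dot (x - z) (x - z).
  by apply: eq_bigr => k _; rewrite expr2.
set u := inv_dist x z.
have uu : dot (x - z) (x - z) * u ^+ 2 = 1.
  by rewrite -enorm_sqr -exprMn divff ?gt_eqF// expr1n.
have E : dot (x - z) (x - z) = enorm x ^+ 2 - 2 * dot x z + 1.
  rewrite dotDr !dotDl !(dotNl, dotNr) (dotC z x) -!enorm_sqr z1.
  by ring.
have -> : dot x (x - z) = enorm x ^+ 2 - dot x z by rewrite dotDr dotNr enorm_sqr.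
have -> : u ^+ n.+4.+1 = u ^+ 2 * u ^+ n.+3 by rewrite -exprD.
have -> : u ^+ n.+1 = dot (x - z) (x - z) * u ^+ n.+3.
  by rewrite -[LHS]mul1r -uu -mulrA -exprD.
have n3 : n.+3%:R = n.+1%:R + 2 :> R by rewrite -natrD addn2.
move: uu; rewrite E n3 -[-2 *+ n.+1]mulr_natr -[(- _) *+ n.+1]mulr_natr.
move: (u ^+ 2) (u ^+ n.+3) (enorm x ^+ 2) (dot x z) (n.+1%:R : R) => U W a s N uu.
have -> : N * (N + 2) * (1 - a) * (a - 2 * s + 1) * (U * W) =
    N * (N + 2) * (1 - a) * W * ((a - 2 * s + 1) * U) by ring.
by rewrite uu; ring.
Qed.

Lemma jcont_1Benorm : jcont (fun x _ => 1 - enorm x ^+ 2).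
Proof.
apply: jcontD; first exact: jcont_cst.
by apply: jcontN; apply: jcont_fst; exact: continuous_enorm_sqr.
Qed.

Lemma jcont_poisson_kernel : jcont (@poisson_kernel R n.+1).
Proof.
rewrite (_ : @poisson_kernel R n.+1 =
    fun x z => (1 - enorm x ^+ 2) * inv_dist x z ^+ n.+1).
  by apply: jcontM; [exact: jcont_1Benorm|apply: jcontX; exact: jcont_inv_dist].
by apply/funext => x; apply/funext => z; rewrite poisson_kernelE.
Qed.

Lemma jcont_poisson_kernel_partial k : jcont (poisson_kernel_partial k).
Proof.
have ju m : jcont (fun x z => inv_dist x z ^+ m).
  by apply: jcontX; exact: jcont_inv_dist.
apply: jcontD.
  apply: jcontM; last exact: ju.
  by apply: jcontM; [exact: jcont_cst|exact: jcont_coord].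
apply: jcontN; apply: jcontM; last exact: ju.
apply: jcontM; first exact: jcont_cst.
by apply: jcontM; [exact: jcont_1Benorm|exact: jcont_sub].
Qed.

Lemma jcont_poisson_kernel_partial2 k : jcont (poisson_kernel_partial2 k).
Proof.
have ju m : jcont (fun x z => inv_dist x z ^+ m).
  by apply: jcontX; exact: jcont_inv_dist.
have jx := @jcont_coord k; have jd := @jcont_sub k; have j1 := jcont_1Benorm.
apply: jcontD; first apply: jcontD; first apply: jcontD.
- by apply: jcontM; [exact: jcont_cst|exact: ju].
- apply: jcontM; last exact: ju.
  by apply: jcontM; [exact: jcont_cst|apply: jcontM].
- apply: jcontN; apply: jcontM; last exact: ju.
  by apply: jcontM; [exact: jcont_cst|exact: j1].
- apply: jcontM; last exact: ju.
  apply: jcontM; last exact: jcontX.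
  by apply: jcontM; [exact: jcont_cst|exact: j1].
Qed.

Lemma bounded_measurableD f g : bounded_measurable f -> bounded_measurable g ->
  bounded_measurable (fun z => f z + g z).
Proof.
move=> [mf [A A0 hA]] [mg [B B0 hB]]; split; first exact: measurable_funD.
exists (A + B) => [|z Sz]; first exact: addr_ge0.
by rewrite (le_trans (ler_normD _ _))// lerD ?hA ?hB.
Qed.

Lemma bounded_measurable_cst (c : R) : bounded_measurable (fun _ : V => c).
Proof. by split; [exact: measurable_cst|exists `|c|]. Qed.

Lemma sphere_integralD f g : bounded_measurable f -> bounded_measurable g ->
  \int[sigma]_(z in S) (f z + g z) =
  \int[sigma]_(z in S) f z + \int[sigma]_(z in S) g z.
Proof.
move=> bf bg; rewrite RintegralD//; first exact: measurable_unit_sphere.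
- exact: bounded_measurable_integrable.
- exact: bounded_measurable_integrable.
Qed.

Lemma sphere_integralZ (c : R) f : bounded_measurable f ->
  \int[sigma]_(z in S) (c * f z) = c * \int[sigma]_(z in S) f z.
Proof.
move=> bf; rewrite RintegralZl//; first exact: measurable_unit_sphere.
exact: bounded_measurable_integrable.
Qed.

Lemma bounded_measurable_sum m (F : 'I_m -> V -> R) :
  (forall j, bounded_measurable (F j)) ->
  bounded_measurable (fun z => \sum_j F j z).
Proof.
elim: m F => [|m IH] F bF.
  rewrite (_ : (fun z => _) = fun=> 0); first exact: bounded_measurable_cst.
  by apply/funext => z; rewrite big_ord0.
rewrite (_ : (fun z => _) = fun z => F ord0 z + \sum_j F (lift ord0 j) z).
  by apply: bounded_measurableD; [exact: bF|apply: IH => j; exact: bF].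
by apply/funext => z; rewrite big_ord_recl.
Qed.

Lemma sphere_integral_sum m (F : 'I_m -> V -> R) :
  (forall j, bounded_measurable (F j)) ->
  \int[sigma]_(z in S) (\sum_j F j z) = \sum_j \int[sigma]_(z in S) F j z.
Proof.
elim: m F => [|m IH] F bF.
  by rewrite big_ord0; under eq_Rintegral do rewrite big_ord0;
    rewrite Rintegral_sphere_cst.
rewrite big_ord_recl -IH; last by move=> j; exact: bF.
under eq_Rintegral do rewrite big_ord_recl.
by rewrite sphere_integralD//; apply: bounded_measurable_sum => j; exact: bF.
Qed.

Local Notation poisson := (kernel_integral (@poisson_kernel R n.+1)).

Lemma poisson_second_partials f : bounded_measurable f ->
  second_partials (@unit_ball R n.+1) (poisson f)
    (fun k => kernel_integral (poisson_kernel_partial k) f)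
    (fun k => kernel_integral (poisson_kernel_partial2 k) f).
Proof.
move=> bf x x1 k; split; apply: kernel_integral_derive => //.
- exact: jcont_poisson_kernel.
- exact: jcont_poisson_kernel_partial.
- by move=> y z y1 z1; exact: is_derive_poisson_kernel.
- exact: jcont_poisson_kernel_partial.
- exact: jcont_poisson_kernel_partial2.
- by move=> y z y1 z1; exact: is_derive_poisson_kernel_partial.
Qed.

Lemma poisson_harmonic f x : bounded_measurable f -> enorm x < 1 ->
  \sum_k kernel_integral (poisson_kernel_partial2 k) f x = 0.
Proof.
move=> bf x1; rewrite /kernel_integral -sphere_integral_sum.
  rewrite -[RHS](@Rintegral_sphere_cst R n); apply: eq_Rintegral => z /set_mem Sz.
  by rewrite -mulr_suml poisson_kernel_laplacian// mul0r.
by move=> k; apply: jcont_bounded_measurable => //; exact: jcont_poisson_kernel_partial2.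
Qed.

End poisson_kernel_derivatives.

(** * Total mass and boundary values of Poisson integrals *)

Section poisson_integrals.
Variables (R : realType) (n : nat).
Hypothesis n_gt0 : (0 < n)%N.
Notation V := 'rV[R]_n.+1.
Notation e_ k := (delta_mx ord0 k : V).
Local Notation sigma := (sphere_measure R n.+1).
Local Notation S := (@unit_sphere R n.+1).
Local Notation P := (@poisson_kernel R n.+1).
Local Notation poisson := (kernel_integral P).
Implicit Types (f : V -> R) (x z : V).

Lemma poisson_kernel_ge0 x z : enorm x <= 1 -> 0 <= P x z.
Proof.
move=> x1; rewrite divr_ge0 ?exprn_ge0 ?enorm_ge0// subr_ge0.
by rewrite exprn_ile1 ?enorm_ge0.
Qed.

(** The farthest point of the sphere from x is at distance 1 + |x|. *)
Lemma poisson_kernel_lower x z : enorm x < 1 -> S z ->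
  (1 - enorm x) / (1 + enorm x) ^+ n <= P x z.
Proof.
move=> x1 z1; have x0 := enorm_ge0 x.
have -> : (1 - enorm x) / (1 + enorm x) ^+ n =
    (1 - enorm x ^+ 2) / (1 + enorm x) ^+ n.+1.
  rewrite [(1 + _) ^+ n.+1]exprS invfM mulrA; congr (_ / _).
  have -> : 1 - enorm x ^+ 2 = (1 - enorm x) * (1 + enorm x) by ring.
  by rewrite mulfK// gt_eqF// ltr_wpDr.
rewrite ler_wpM2l ?subr_ge0 ?exprn_ile1 ?(ltW x1)//.
rewrite lef_pV2 ?posrE ?exprn_gt0 ?enorm_sub_gt0 ?ltr_wpDr//.
rewrite lerXn2r ?nnegrE ?enorm_ge0 ?addr_ge0// addrC.
by rewrite (le_trans (ler_enormD _ _))// enormN z1.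
Qed.

Lemma rigid_poisson_mass T x : rigid T -> enorm x < 1 ->
  \int[sigma]_(z in S) P (T x) z = \int[sigma]_(z in S) P x z.
Proof.
move=> rT x1; have Tx1 : enorm (T x) < 1 by rewrite (rigid_enorm rT).
rewrite -(sphere_integral_rigid rT).
- apply: eq_Rintegral => z _; rewrite /poisson_kernel -(rigidB rT).
  by rewrite !(rigid_enorm rT).
- apply: continuous_within_measurable; first exact: measurable_unit_sphere.
  by apply: jcont_within => //; exact: jcont_poisson_kernel.
- by move=> z _; apply: poisson_kernel_ge0; exact: ltW.
Qed.

Lemma bounded_measurable_poisson x f : enorm x < 1 -> bounded_measurable f ->
  bounded_measurable (fun z => P x z * f z).
Proof. by move=> x1; apply: jcont_bounded_measurable => //; exact: jcont_poisson_kernel. Qed.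

Lemma bounded_measurable_poisson1 x : enorm x < 1 -> bounded_measurable (P x).
Proof.
move=> x1; apply: within_bounded_measurable.
by apply: jcont_within => //; exact: jcont_poisson_kernel.
Qed.

Lemma poisson_within f (r : R) : r < 1 -> bounded_measurable f ->
  {within [set x | enorm x <= r], continuous (poisson f)}.
Proof.
move=> r1 bf; apply: continuous_in_subspaceT => x /set_mem/= xr.
apply: kernel_integral_continuous => //; first exact: jcont_poisson_kernel.
exact: le_lt_trans r1.
Qed.

(** The mass is a harmonic function of x, and a radial one since the kernel and
    the surface measure are both rotation invariant. The maximum principle for it
    and for its opposite on the ball of radius |x|, on whose boundary it is
    constant, equates its values at x and at 0. *)
Lemma poisson_mass x : enorm x < 1 -> \int[sigma]_(z in S) P x z = 1.
Proof.
move=> x1; pose p := poisson (fun=> 1).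
have pE y : p y = \int[sigma]_(z in S) P y z.
  by apply: eq_Rintegral => z _; rewrite mulr1.
have p0 : p 0 = 1.
  rewrite pE -[RHS](@Rintegral_sphere_cst R n); apply: eq_Rintegral => z /set_mem Sz.
  by rewrite /poisson_kernel enorm0 sub0r enormN Sz expr0n subr0 expr1n divr1.
pose r := enorm x.
have prad y : enorm y = r -> p y = p x.
  move=> yr; have [T rT Te] := rigid_transitive x n_gt0.
  have [T' rT' Te'] := rigid_transitive y n_gt0.
  have re : enorm (enorm x *: e_ ord0) < 1.
    by rewrite enormZ enorm_delta mulr1 ger0_norm ?enorm_ge0.
  rewrite !pE -Te' yr -[in RHS]Te (rigid_poisson_mass rT' re).
  by rewrite (rigid_poisson_mass rT re).
have pc c y : enorm y < 1 -> poisson (fun=> c) y = c * p y.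
  move=> y1; rewrite pE -sphere_integralZ; last first.
    exact: bounded_measurable_poisson1.
  by apply: eq_Rintegral => z _; rewrite mulrC.
have max_p c : poisson (fun=> c) 0 <= poisson (fun=> c) x.
  have bc := @bounded_measurable_cst R n c.
  have dp : second_partials [set y : V | enorm y < r] (poisson (fun=> c))
      (fun k => kernel_integral (poisson_kernel_partial k) (fun=> c))
      (fun k => kernel_integral (poisson_kernel_partial2 k) (fun=> c)).
    by move=> y yr; apply: poisson_second_partials => //; exact: lt_trans yr x1.
  apply: (maximum_principle dp (poisson_within x1 bc)).
  - by move=> y yr; rewrite poisson_harmonic// (lt_trans yr).
  - move=> y yr; have y1 : enorm y < 1 by rewrite yr.
    by rewrite (pc c x x1) (pc c y y1) (prad y yr) lexx.
  - by rewrite enorm0 enorm_ge0.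
have := max_p 1; have := max_p (-1); rewrite !pc ?enorm0// p0 pE.
lra.
Qed.

Lemma near_ball_enorm (x : V) (A : set V) : nbhs x A ->
  exists2 d, 0 < d & forall y, enorm (y - x) < d -> A y.
Proof.
move=> /nbhs_ballP[d /= d0 dA]; exists d => // y yd; apply: dA.
rewrite -ball_normE /= -normrN opprB.
exact: le_lt_trans (mx_norm_le_enorm _) yd.
Qed.

(** Poisson integrals have the right boundary values: the mass of P(x, -) is 1,
    and at distance at least d from a boundary point z0 the kernel is at most
    (1 - |x|^2) (2 / d)^(n+1) for x close to z0, which vanishes as x tends to
    z0. *)
Lemma poisson_boundary f z0 (e : R) : {within S, continuous f} -> S z0 -> 0 < e ->
  exists2 eta, 0 < eta & forall x, enorm x < 1 -> enorm (x - z0) < eta ->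
    `|poisson f x - f z0| <= e.
Proof.
move=> cf Sz0 e0; have bf := within_bounded_measurable cf.
have [B B0 hB] := bf.2.
have [d d0 hd] : exists2 d, 0 < d & forall z, S z -> enorm (z - z0) < d ->
    `|f z - f z0| <= e / 2.
  have e20 : 0 < e / 2 by rewrite divr_gt0.
  have cfz := (proj1 (subspace_continuousP S f) cf) z0 Sz0; move: cfz.
  move=> /cvgrPdist_le/(_ _ e20); rewrite near_withinE => /near_ball_enorm[d d0 h].
  by exists d => // z Sz zd; rewrite distrC h.
(* If |x - z0| < eta then 1 - |x|^2 <= 2 eta, so that the points z at distance at
   least d from z0, where f oscillates by at most 2 B, contribute at most
   C eta. *)
pose C := 2 * B * (2 * (2 / d) ^+ n.+1).
have C0 : 0 <= C by rewrite !mulr_ge0// exprn_ge0// divr_ge0// ltW.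
exists (Num.min (d / 2) (e / 2 / (C + 1))).
  by rewrite lt_min !divr_gt0// ltr_wpDl.
move=> x x1; rewrite lt_min => /andP[xd xe].
have -> : poisson f x - f z0 = \int[sigma]_(z in S) (P x z * (f z - f z0)).
  transitivity (\int[sigma]_(z in S) (P x z * f z + - f z0 * P x z)).
    rewrite sphere_integralD; first last.
    - apply: bounded_measurableM; first exact: bounded_measurable_cst.
      exact: bounded_measurable_poisson1.
    - exact: bounded_measurable_poisson.
    rewrite sphere_integralZ ?poisson_mass ?mulr1//.
    exact: bounded_measurable_poisson1.
  by apply: eq_Rintegral => z _; ring.
have bd : bounded_measurable (fun z => f z - f z0).
  by apply: bounded_measurableD => //; exact: bounded_measurable_cst.
have near1 : 1 - enorm x ^+ 2 <= 2 * (e / 2 / (C + 1)).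
  have : 1 - enorm x <= enorm (x - z0) by rewrite enormB -Sz0 ler_enormB.
  have := enorm_ge0 x; nra.
pose b z := e / 2 * P x z + 2 * B * (2 * (e / 2 / (C + 1)) * (2 / d) ^+ n.+1).
have Pf z : S z -> `|P x z * (f z - f z0)| <= b z.
  move=> Sz; have P0 := poisson_kernel_ge0 z (ltW x1).
  rewrite normrM ger0_norm//.
  have e20 : 0 <= e / 2 by rewrite divr_ge0// ltW.
  have eC : 0 <= 2 * (e / 2 / (C + 1)).
    by rewrite mulr_ge0// divr_ge0// addr_ge0.
  have pw : 0 <= (2 / d) ^+ n.+1 by rewrite exprn_ge0// divr_ge0// ltW.
  have [zd|zd] := ltP (enorm (z - z0)) d.
    rewrite (@le_trans _ _ (e / 2 * P x z))//.
      by rewrite mulrC ler_wpM2r// hd.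
    by rewrite lerDl; apply: mulr_ge0; exact: mulr_ge0.
  rewrite (@le_trans _ _ (2 * B * (2 * (e / 2 / (C + 1)) * (2 / d) ^+ n.+1)))//.
    rewrite mulrC ler_pM//.
      rewrite (le_trans (ler_normB _ _))// mulr2n mulrDl !mul1r.
      by rewrite lerD ?hB.
    have xz : d / 2 <= enorm (x - z).
      have := ler_enormD (z - x) (x - z0); rewrite addrA subrK (enormB z x).
      lra.
    rewrite /poisson_kernel -exprVn ler_pM ?exprn_ge0 ?invr_ge0 ?enorm_ge0//.
      by rewrite subr_ge0 exprn_ile1 ?enorm_ge0// ltW.
    rewrite lerXn2r ?nnegrE ?invr_ge0 ?enorm_ge0 ?divr_ge0 ?(ltW d0)//.
    by rewrite -[leRHS]invf_div lef_pV2 ?posrE ?divr_gt0 ?enorm_sub_gt0.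
  by rewrite lerDr mulr_ge0.
have bb : bounded_measurable b.
  apply: bounded_measurableD; last exact: bounded_measurable_cst.
  apply: bounded_measurableM; first exact: bounded_measurable_cst.
  exact: bounded_measurable_poisson1.
have bPf : bounded_measurable (fun z => P x z * (f z - f z0)).
  exact: bounded_measurable_poisson.
have bPfn : bounded_measurable (fun z => `|P x z * (f z - f z0)|).
  have [mh [B' B'0 hB']] := bPf; split; last by exists B' => // z Sz; rewrite normr_id hB'.
  exact: (measurableT_comp (@normr_measurable _ setT)).
apply: (le_trans (le_normr_Rintegral _ _)).
- exact: measurable_unit_sphere.
- exact: bounded_measurable_integrable.
apply: (@le_trans _ _ (\int[sigma]_(z in S) b z)).
  apply: le_Rintegral => //; first exact: measurable_unit_sphere.
  - exact: (bounded_measurable_integrable bPfn).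
  - exact: bounded_measurable_integrable.
rewrite sphere_integralD; first last.
- exact: bounded_measurable_cst.
- apply: bounded_measurableM; first exact: bounded_measurable_cst.
  exact: bounded_measurable_poisson1.
rewrite sphere_integralZ ?poisson_mass ?mulr1//; last exact: bounded_measurable_poisson1.
rewrite Rintegral_sphere_cst [leRHS](splitr e) lerD2l.
have -> : 2 * B * (2 * (e / 2 / (C + 1)) * (2 / d) ^+ n.+1) = C * (e / 2 / (C + 1)).
  by rewrite /C; ring.
rewrite mulrA ler_pdivrMr ?ltr_wpDl// mulrC ler_wpM2l ?lerDl//.
by rewrite divr_ge0// ltW.
Qed.

End poisson_integrals.

(** * The inequality *)

Section inequality.
Variables (R : realType) (n : nat).
Hypothesis n_gt0 : (0 < n)%N.
Notation V := 'rV[R]_n.+1.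
Local Notation sigma := (sphere_measure R n.+1).
Local Notation S := (@unit_sphere R n.+1).
Local Notation P := (@poisson_kernel R n.+1).
Local Notation poisson := (kernel_integral P).
Local Notation B := (@unit_ball R n.+1).
Local Notation cB := (@unit_cball R n.+1).

Lemma second_partials_eq (U : set V) (h g : V -> R) h1 h2 : open U ->
  (forall x, U x -> h x = g x) ->
  second_partials U h h1 h2 -> second_partials U g h1 h2.
Proof.
move=> oU hg dh x Ux k; have [d1 d2] := dh x Ux k; split => //.
apply: near_eq_is_derive d1; have : nbhs x U by exact: open_nbhs_nbhs.
exact: filterS.
Qed.

Lemma sphere_sub_cball : S `<=` cB.
Proof. by move=> z; rewrite /unit_sphere /unit_cball/= => ->. Qed.

Definition poisson_ext (h : V -> R) (x : V) : R :=
  if enorm x < 1 then poisson h x else h x.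

Lemma poisson_ext_continuous (h : V -> R) :
  {within cB, continuous h} -> {within cB, continuous (poisson_ext h)}.
Proof.
move=> ch; apply/subspace_continuousP => x; rewrite /from_subspace /unit_cball/= le_eqVlt.
have chS : {within S, continuous h} by exact: continuous_subspaceW sphere_sub_cball ch.
move=> /predU1P[x1|x1]; last first.
  have bh := within_bounded_measurable chS.
  have cp := kernel_integral_continuous (@jcont_poisson_kernel R n) bh x1.
    have -> : poisson_ext h x = poisson h x by rewrite /poisson_ext x1.
  apply: cvg_within_filter.
  apply: cvg_trans cp; apply: near_eq_cvg.
  have := open_nbhs_nbhs (conj (@open_ball_open R n.+1 1) x1).
  by apply: filterS => y /= y1; rewrite /poisson_ext y1.
have hx : poisson_ext h x = h x by rewrite /poisson_ext x1 ltxx.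
rewrite hx; apply/(cvgrPdist_le (F := within cB (nbhs x))) => e e0.
have [eta eta0 heta] := poisson_boundary n_gt0 chS x1 e0.
have x1' : cB x by rewrite /unit_cball/= x1.
have := proj1 (subspace_continuousP cB h) ch x x1'.
move=> /(cvgrPdist_le (F := within cB (nbhs x)))/(_ _ e0) nh.
have ne : \forall y \near within cB (nbhs x), enorm (y - x) < eta.
  by apply: cvg_within; exact: near_enorm_lt.
apply: filterS2 nh ne => y hy yx; rewrite /poisson_ext; case: ifP => // y1.
by rewrite distrC; apply: heta.
Qed.

(** The difference h - P[h] is subharmonic and vanishes on the sphere. *)
Lemma subharmonic_le_poisson (h : V -> R) h1 h2 :
  {within cB, continuous h} -> second_partials B h h1 h2 ->
  (forall x, enorm x < 1 -> 0 <= \sum_k h2 k x) ->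
  forall x, enorm x < 1 -> h x <= poisson h x.
Proof.
move=> ch dh lh x x1.
have chS : {within S, continuous h} by exact: continuous_subspaceW sphere_sub_cball ch.
have bh := within_bounded_measurable chS.
have dp := poisson_second_partials bh.
have eqU y : B y -> poisson h y = poisson_ext h y.
  by rewrite /unit_ball/poisson_ext/= => ->.
have dU := second_partials_eq (@open_ball_open R n.+1 1) eqU dp.
have dv := second_partialsD (-1) dh dU.
have cv : {within cB, continuous (fun y => h y + -1 * poisson_ext h y)}.
  rewrite (_ : (fun y => _) = h - poisson_ext h).
    by apply: within_continuousB => //; exact: poisson_ext_continuous.
  by apply/funext => y; rewrite mulN1r.
have := maximum_principle dv cv (C := 0) _ _ (ltW x1).
rewrite /poisson_ext x1 mulN1r subr_le0; apply.
- move=> y y1; rewrite big_split/= -mulr_sumr poisson_harmonic//.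
  by rewrite mulr0 addr0 lh.
- by move=> y y1; rewrite y1 ltxx mulN1r subrr.
Qed.

Variable m : nat.
Implicit Types (e : 'rV[R]_m) (f g : V -> 'rV[R]_m).

Lemma continuous_dot e : continuous (dot e).
Proof.
apply: continuous_big => [|i _ x]; first exact: add_continuous.
apply: (continuousM (s := cst (e ord0 i)) (t := fun x : 'rV[R]_m => x ord0 i)).
  exact: cst_continuous.
exact: coord_continuous.
Qed.

Lemma within_dot (A : set V) e f : {within A, continuous f} ->
  {within A, continuous (fun x => dot e (f x))}.
Proof.
move=> cf x; apply: (@continuous_comp _ _ _ (f : subspace A -> _) (dot e)).
  exact: cf.
exact: continuous_dot.
Qed.

Lemma within_enorm (A : set V) f : {within A, continuous f} ->
  {within A, continuous (fun x => enorm (f x))}.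
Proof.
move=> cf x; apply: (@continuous_comp _ _ _ (f : subspace A -> _) (@enorm R m)).
  exact: cf.
exact: continuous_enorm.
Qed.

Lemma dot_poisson e f x : {within S, continuous f} -> enorm x < 1 ->
  poisson (fun z => dot e (f z)) x = dot e (poisson_integral f x).
Proof.
move=> cf x1; have bf j : bounded_measurable (fun z => f z ord0 j).
  rewrite (_ : (fun z => _) = fun z => dot (delta_mx ord0 j) (f z)).
    by apply: within_bounded_measurable; exact: within_dot.
  by apply/funext => z; rewrite dotC dot_delta.
have bP j : bounded_measurable (fun z => P x z * f z ord0 j).
  exact: bounded_measurable_poisson.
rewrite /dot; under [RHS]eq_bigr do rewrite mxE -sphere_integralZ//.
rewrite -sphere_integral_sum; last first.
  by move=> j; apply: bounded_measurableM => //; exact: bounded_measurable_cst.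
apply: eq_Rintegral => z _; rewrite mulr_sumr; apply: eq_bigr => j _.
by rewrite mulrCA.
Qed.

Lemma sup_norm_ub (h : V -> 'rV[R]_m) (C : R) :
  (forall y, enorm y < 1 -> enorm (h y) <= C) ->
  forall x, enorm x < 1 -> enorm (h x) <= sup_norm h.
Proof.
move=> hC x x1; apply: ub_le_sup; last by exists x.
by exists C => _ [y y1 <-]; exact: hC.
Qed.

Lemma poisson_le (h : V -> R) (C : R) x : {within S, continuous h} ->
  (forall z, S z -> h z <= C) -> enorm x < 1 -> poisson h x <= C.
Proof.
move=> ch hC x1; have bh := within_bounded_measurable ch.
have b1 := bounded_measurable_poisson1 x1.
rewrite -[leRHS]mulr1 -(poisson_mass n_gt0 x1) -sphere_integralZ//.
apply: le_Rintegral; first exact: measurable_unit_sphere.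
- by apply: bounded_measurable_integrable; exact: bounded_measurable_poisson.
- apply: bounded_measurable_integrable; apply: bounded_measurableM => //.
  exact: bounded_measurable_cst.
- by move=> z Sz; rewrite mulrC ler_wpM2r ?hC// poisson_kernel_ge0// ltW.
Qed.

Lemma poisson_integral_ub f : {within S, continuous f} ->
  forall x, enorm x < 1 ->
    enorm (poisson_integral f x) <= sup_norm (poisson_integral f).
Proof.
move=> cf; have [C _ hC] := within_sphere_bounded (within_enorm cf).
apply: (sup_norm_ub (C := C)) => x x1.
have [e e1 <-] := unit_direction (poisson_integral f x).
rewrite -dot_poisson//; apply: poisson_le => // [|z Sz]; first exact: within_dot.
rewrite (le_trans (dot_le _ _))// -[leRHS]mul1r ler_pM ?enorm_ge0//.
by rewrite (le_trans (ler_norm _)) ?hC.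
Qed.

(** Boundary values are limits of values of the Poisson integral. *)
Lemma boundary_le_sup_norm f z : {within S, continuous f} -> S z ->
  enorm (f z) <= sup_norm (poisson_integral f).
Proof.
move=> cf Sz; have [e e1 <-] := unit_direction (f z).
apply/ler_addgt0Pr => eps eps0.
have [eta eta0 heta] := poisson_boundary n_gt0 (within_dot (e := e) cf) Sz eps0.
pose t := Num.min (eta / 2) (1 / 2).
have t0 : 0 < t by rewrite lt_min !divr_gt0.
have th : t <= 1 / 2 by rewrite ge_min lexx orbT.
have te : t < eta by rewrite gt_min ltr_pdivrMr// ltr_pMr// ltr1n.
have x1 : enorm ((1 - t) *: z) < 1.
  by rewrite enormZ Sz mulr1 ger0_norm; lra.
have xz : enorm ((1 - t) *: z - z) < eta.
  by rewrite scalerBl scale1r addrAC subrr add0r enormN enormZ Sz mulr1 gtr0_norm.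
have := heta _ x1 xz; rewrite distrC ler_norml => /andP[_ h].
have : poisson (fun z => dot e (f z)) ((1 - t) *: z) <= sup_norm (poisson_integral f).
  rewrite dot_poisson//; apply: le_trans (poisson_integral_ub cf x1).
  by rewrite (le_trans (dot_le _ _))// ler_piMl// enorm_ge0.
lra.
Qed.

Lemma class_C2_second_partials (U : set V) (h : V -> R) : class_C2 U h ->
  second_partials U h (fun k => partial k h) (fun k => partial k (partial k h)).
Proof.
move=> ch x Ux k; have [_ /(_ k)[d1 _] /(_ k k)[d2 _]] := ch x Ux.
by split; [exact: derivableP d1|exact: derivableP d2].
Qed.

(** Adding sup |g| |x|^2 / (2 N), for N the dimension, makes e . f subharmonic;
    the added function is constant on the sphere. *)
Lemma solution_le_poisson f g e x : poisson_solution g f -> enorm e <= 1 ->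
  enorm x < 1 ->
  dot e (f x) <= dot e (poisson_integral f x)
    + sup_norm g / (2 * n.+1%:R) * (1 - enorm x ^+ 2).
Proof.
move=> [cg cf C2f lf] e1 x1; set c := sup_norm g / _.
have cfS : {within S, continuous f} by exact: continuous_subspaceW sphere_sub_cball cf.
have [C _ hC] := compact_within_bounded (@closed_ball_compact R n.+1 1) (within_enorm cg).
have gG y : enorm y < 1 -> enorm (g y) <= sup_norm g.
  apply: (sup_norm_ub (C := C)) => {}y y1.
  by apply: (le_trans (ler_norm _)); apply: hC; exact: ltW.
have df j := class_C2_second_partials (C2f j).
have de := second_partials_sum (fun j => e ord0 j) df.
have dh := second_partialsD c de (@second_partials_enorm_sqr R n B).
have ch : {within cB, continuous (fun y => dot e (f y) + c * enorm y ^+ 2)}.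
  apply: within_continuousD; first exact: within_dot.
  apply: continuous_subspaceT => y.
  apply: (continuousM (s := cst c) (t := fun y => enorm y ^+ 2)).
    exact: cst_continuous.
  exact: continuous_enorm_sqr.
have lap y : enorm y < 1 -> 0 <= \sum_k (\sum_j e ord0 j *
    partial k (partial k (fun x => f x ord0 j)) y + c * 2).
  move=> y1; rewrite big_split/= exchange_big/=.
  have -> : \sum_(j < m) \sum_(i < n.+1) e ord0 j *
      partial i (partial i (fun x => f x ord0 j)) y = dot e (g y).
    by apply: eq_bigr => j _; rewrite -lf// mxE mulr_sumr.
  have -> : \sum_(k < n.+1) c * 2 = sup_norm g.
    by rewrite sumr_const card_ord -[LHS]mulr_natr -mulrA divfK//.
  rewrite -lerBlDl sub0r -dotNl (le_trans (dot_le _ _))// enormN.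
  by rewrite (le_trans _ (gG y y1))// ler_piMl// enorm_ge0.
have := subharmonic_le_poisson ch dh lap x1.
have bc : bounded_measurable (fun z : V => c * enorm z ^+ 2).
  apply: within_bounded_measurable; apply: continuous_subspaceT => y.
  apply: (continuousM (s := cst c) (t := fun y => enorm y ^+ 2)).
    exact: cst_continuous.
  exact: continuous_enorm_sqr.
have be : bounded_measurable (fun z => dot e (f z)).
  by apply: within_bounded_measurable; exact: within_dot.
have -> : poisson (fun y => dot e (f y) + c * enorm y ^+ 2) x =
    dot e (poisson_integral f x) + c.
  rewrite -dot_poisson//.
  transitivity (\int[sigma]_(z in S) (P x z * dot e (f z) + c * P x z)).
    apply: eq_Rintegral => z /set_mem Sz.
    by rewrite mulrDr Sz expr1n mulr1 [c * _]mulrC.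
  have b1 := bounded_measurable_poisson1 x1.
  rewrite sphere_integralD; first last.
  - by apply: bounded_measurableM => //; exact: bounded_measurable_cst.
  - exact: bounded_measurable_poisson.
  by rewrite sphere_integralZ// poisson_mass// mulr1.
lra.
Qed.

(** P(x, -) - c is nonnegative with integral 1 - c, where
    c = (1 - |x|) / (1 + |x|)^n in dimension n + 1, and P(0, -) = 1. *)
Lemma poisson_schwarz f e x : {within S, continuous f} -> enorm e <= 1 ->
  enorm x < 1 ->
  dot e (poisson_integral f x) -
    (1 - enorm x) / (1 + enorm x) ^+ n * dot e (poisson_integral f 0)
  <= sup_norm (poisson_integral f) * (1 - (1 - enorm x) / (1 + enorm x) ^+ n).
Proof.
move=> cf e1 x1; set c := _ / _; set M := sup_norm _.
have o1 : enorm (0 : V) < 1 by rewrite enorm0.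
have be : bounded_measurable (fun z => dot e (f z)).
  by apply: within_bounded_measurable; exact: within_dot.
have bc (a : R) := @bounded_measurable_cst R n a.
have b1 := bounded_measurable_poisson1 x1.
have b0 := bounded_measurable_poisson1 o1.
rewrite -!dot_poisson// [M * _]mulrC -mulNr.
have -> : - c * poisson (fun z => dot e (f z)) 0 = \int[sigma]_(z in S) (- c * dot e (f z)).
  rewrite sphere_integralZ//; congr (_ * _); apply: eq_Rintegral => z /set_mem Sz.
  by rewrite /poisson_kernel enorm0 sub0r enormN Sz expr0n subr0 expr1n divr1 mul1r.
rewrite -sphere_integralD; first last.
- exact: bounded_measurableM.
- exact: bounded_measurable_poisson.
have -> : (1 - c) * M = \int[sigma]_(z in S) (M * (P x z + - c)).
  rewrite sphere_integralZ; last exact: bounded_measurableD.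
  by rewrite sphere_integralD// poisson_mass// Rintegral_sphere_cst mulrC.
apply: le_Rintegral; first exact: measurable_unit_sphere.
- apply: bounded_measurable_integrable; apply: bounded_measurableD.
    exact: bounded_measurable_poisson.
  exact: bounded_measurableM.
- apply: bounded_measurable_integrable; apply: bounded_measurableM => //.
  exact: bounded_measurableD.
move=> z Sz; rewrite -mulrDl mulrC ler_wpM2r//.
  by rewrite subr_ge0 poisson_kernel_lower.
rewrite (le_trans (dot_le _ _))// -[leRHS]mul1r ler_pM ?enorm_ge0//.
exact: boundary_le_sup_norm.
Qed.

Lemma schwarz_inequality f g x : poisson_solution g f -> unit_cball x ->
  enorm (f x - ((1 - enorm x) / (1 + enorm x) ^+ n) *: poisson_integral f 0)
  <= sup_norm (poisson_integral f) * (1 - (1 - enorm x) / (1 + enorm x) ^+ n)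
     + sup_norm g / (2 * n.+1%:R) * (1 - enorm x ^+ 2).
Proof.
move=> sol; have [_ cf _ _] := sol.
have cfS : {within S, continuous f} by exact: continuous_subspaceW sphere_sub_cball cf.
rewrite /unit_cball/= le_eqVlt => /predU1P[x1|x1].
  rewrite x1 subrr mul0r scale0r !subr0 expr1n subrr mulr0 mulr1 addr0.
  exact: boundary_le_sup_norm.
set v := f x - _; have [e e1 <-] := unit_direction v.
rewrite dotDr dotNr dotZr; set c := (1 - enorm x) / (1 + enorm x) ^+ n.
have h1 := solution_le_poisson sol e1 x1; have h2 := poisson_schwarz cfS e1 x1.
by rewrite lerBlDr (le_trans h1)// addrAC lerD2r -lerBlDr.
Qed.

End inequality.

(** * Sharpness *)

Section sharpness.
Variables (R : realType) (n m : nat).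
Notation V := 'rV[R]_n.+1.
Notation e_ k := (delta_mx ord0 k : V).

(** Being C2 on an open set is local: the values of f are known on the closed
    ball only. *)
Lemma class_C2_eq (U : set V) (h g : V -> R) : open U ->
  (forall x, U x -> h x = g x) -> class_C2 U h -> class_C2 U g.
Proof.
move=> oU hg ch.
have nU x : U x -> nbhs x U by move=> Ux; exact: open_nbhs_nbhs.
have near_cont (p q : V -> R) x : (forall y, U y -> p y = q y) -> U x ->
    {for x, continuous p} -> {for x, continuous q}.
  move=> pq Ux cp; have {}cp : p y @[y --> x] --> q x by rewrite -(pq x Ux).
  apply: cvg_trans cp; apply: (near_eq_cvg (F := nbhs x)).
  by apply: filterS (nU x Ux) => y Uy; rewrite pq.
have der_eq (p q : V -> R) x v : (forall y, U y -> p y = q y) -> U x ->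
    derivable p x v -> derivable q x v.
  by move=> pq Ux; apply: near_eq_derivable; exact: (filterS pq (nU x Ux)).
have par_eq (p q : V -> R) i x : (forall y, U y -> p y = q y) -> U x ->
    partial i p x = partial i q x.
  by move=> pq Ux; apply: near_eq_derive; exact: (filterS pq (nU x Ux)).
move=> x Ux; have [c0 c1 c2] := ch x Ux; split.
- exact: near_cont c0.
- move=> i; have [d1 d2] := c1 i; split; first exact: (der_eq _ _ _ _ hg Ux d1).
  by apply: (near_cont _ _ _ _ Ux d2) => y; exact: par_eq.
- move=> i j; have [d1 d2] := c2 i j.
  have e1 y : U y -> partial i h y = partial i g y by exact: par_eq.
  split; first exact: (der_eq _ _ _ _ e1 Ux d1).
  by apply: (near_cont _ _ _ _ Ux d2) => y Uy; exact: (par_eq _ _ _ _ e1 Uy).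
Qed.

Definition paraboloid (c : R) (x : V) : R := c * (1 - enorm x ^+ 2).

Lemma partial_paraboloid c i : partial i (paraboloid c) = fun x => c * (-2 * x ord0 i).
Proof.
apply/funext => x; apply: derive_val.
exact: (is_deriveZ c (is_derive_1Benorm x i)).
Qed.

Lemma is_derive_partial_paraboloid c i j x :
  is_derive x (e_ j) (partial i (paraboloid c)) (c * (-2 * (i == j)%:R)).
Proof.
rewrite partial_paraboloid.
exact: (is_deriveZ c (is_deriveZ (-2) (is_derive_coordE x i j))).
Qed.

Lemma partial2_paraboloid c i j :
  partial j (partial i (paraboloid c)) = fun=> c * (-2 * (i == j)%:R).
Proof.
by apply/funext => x; apply: derive_val; exact: is_derive_partial_paraboloid.
Qed.

Lemma continuous_paraboloid c : continuous (paraboloid c).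
Proof.
move=> x; apply: (continuousM (s := cst c) (t := fun y : V => 1 - enorm y ^+ 2)).
  exact: cst_continuous.
apply: (continuousB (f := cst (1 : R)) (g := fun y : V => enorm y ^+ 2)).
  exact: cst_continuous.
exact: continuous_enorm_sqr.
Qed.

Lemma class_C2_paraboloid (U : set V) c : class_C2 U (paraboloid c).
Proof.
move=> x _; split; first exact: continuous_paraboloid.
- move=> i; split.
    by have [] := is_deriveZ c (is_derive_1Benorm x i).
  rewrite partial_paraboloid.
  apply: (continuousM (s := cst c) (t := fun y : V => -2 * y ord0 i)).
    exact: cst_continuous.
  apply: (continuousM (s := cst (-2)) (t := fun y : V => y ord0 i)).
    exact: cst_continuous.
  exact: coord_continuous.
- move=> i j; split; first by have [] := is_derive_partial_paraboloid c i j x.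
  by rewrite partial2_paraboloid; exact: cst_continuous.
Qed.

Lemma enorm_first_coord (c : R) : (0 < m)%N -> enorm (first_coord m c) = `|c|.
Proof.
case: m => // m' _; rewrite /enorm big_ord_recl big1 => [|i _]; rewrite !mxE//=.
  by rewrite addr0 sqrtr_sqr.
by rewrite expr0n.
Qed.

Lemma first_coordZ (c : R) : first_coord m c = c *: first_coord m 1.
Proof.
by apply/rowP => j; rewrite !mxE; case: ifP; rewrite ?mulr1 ?mulr0.
Qed.

Lemma first_coord0 : first_coord m (0 : R) = 0.
Proof. by rewrite first_coordZ scale0r. Qed.

Variables (M : R) (f g : V -> 'rV[R]_m).
Hypothesis M_gt0 : 0 < M.
Hypothesis gE : forall x, unit_cball x -> g x = first_coord m (- (2 * n.+1%:R * M)).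
Hypothesis fE : forall x, unit_cball x -> f x = first_coord m (M * (1 - enorm x ^+ 2)).

Lemma paraboloid_solution : poisson_solution g f.
Proof.
pose c (j : 'I_m) := if j == 0 :> nat then M else 0.
have fj j x : unit_cball x -> f x ord0 j = paraboloid (c j) x.
  by move=> x1; rewrite fE// mxE /paraboloid /c; case: ifP; rewrite ?mul0r.
have oB : open (@unit_ball R n.+1) by exact: open_ball_open.
have BcB (x : V) : unit_ball x -> unit_cball x by move=> x1; exact: ltW.
have fjB j x : unit_ball x -> paraboloid (c j) x = f x ord0 j.
  by move=> x1; rewrite fj//; exact: BcB.
split.
- apply: (@subspace_eq_continuous _ _ _ (fun=> first_coord m (- (2 * n.+1%:R * M)))).
    by move=> x /set_mem x1; rewrite /= /from_subspace gE.
  by apply: continuous_subspaceT => x; exact: cst_continuous.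
- apply: (@subspace_eq_continuous _ _ _ (fun x => paraboloid M x *: first_coord m 1)).
    by move=> x /set_mem x1; rewrite /= /from_subspace fE// [RHS]first_coordZ.
  apply: continuous_subspaceT => x.
  by apply: continuousZr_tmp; exact: continuous_paraboloid.
- move=> j; apply: (class_C2_eq oB (fjB j)); exact: class_C2_paraboloid.
- move=> x x1; rewrite gE; last exact: BcB.
  apply/rowP => j; rewrite !mxE /laplacian.
  transitivity (\sum_(k < n.+1) c j * -2).
    apply: eq_bigr => k _.
    have e1 y : unit_ball y -> partial k (paraboloid (c j)) y =
        partial k (fun y => f y ord0 j) y.
      move=> y1; apply: near_eq_derive; apply: (filterS _ (open_nbhs_nbhs (conj oB y1))).
      exact: fjB.
    transitivity (partial k (partial k (paraboloid (c j))) x).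
      apply/esym/near_eq_derive; apply: (filterS _ (open_nbhs_nbhs (conj oB x1))).
      exact: e1.
    by rewrite partial2_paraboloid eqxx mulr1.
  rewrite sumr_const card_ord -[LHS]mulr_natr /c; case: ifP => _; last by rewrite !mul0r.
  ring.
Qed.

Lemma poisson_integral_paraboloid x : poisson_integral f x = 0.
Proof.
apply/rowP => j; rewrite !mxE -[RHS](@Rintegral_sphere_cst R n).
apply: eq_Rintegral => z /set_mem; rewrite /unit_sphere/= => z1.
rewrite fE; last by rewrite /unit_cball/= z1.
by rewrite z1 expr1n subrr mulr0 first_coord0 mxE mulr0.
Qed.

Lemma sup_norm_cst (h : V -> 'rV[R]_m) (c : R) :
  (forall x, enorm x < 1 -> enorm (h x) = c) -> sup_norm h = c.
Proof.
move=> hc; rewrite /sup_norm (_ : [set _ | x in _] = [set c]) ?sup1//.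
apply/seteqP; split => [_ [x x1 <-]|_ ->]; first by rewrite /= hc.
by exists 0; rewrite ?hc// /unit_ball/= enorm0.
Qed.

(** As P[f] = 0, both sides are M (1 - |x|^2). *)
Lemma paraboloid_equality x : (0 < m)%N -> unit_cball x ->
  enorm (f x - ((1 - enorm x) / (1 + enorm x) ^+ n) *: poisson_integral f 0)
  = sup_norm (poisson_integral f) * (1 - (1 - enorm x) / (1 + enorm x) ^+ n)
     + sup_norm g / (2 * n.+1%:R) * (1 - enorm x ^+ 2).
Proof.
move=> m0 x1; rewrite poisson_integral_paraboloid scaler0 subr0.
rewrite (@sup_norm_cst (poisson_integral f) 0); last first.
  by move=> y _; rewrite poisson_integral_paraboloid enorm0.
rewrite (@sup_norm_cst g (2 * n.+1%:R * M)); last first.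
  move=> y y1; rewrite gE; last exact: ltW.
  by rewrite enorm_first_coord// normrN ger0_norm// !mulr_ge0// ltW.
rewrite fE// enorm_first_coord// mul0r add0r.
rewrite ger0_norm; last by rewrite mulr_ge0 ?(ltW M_gt0)// subr_ge0 exprn_ile1 ?enorm_ge0.
by congr (_ * _); rewrite mulrC mulKf// mulf_neq0// pnatr_eq0.
Qed.

End sharpness.

Theorem corollary1 (R : realType) (n m : nat) (hn : (3 <= n)%N)
    (hm : (1 <= m)%N) :
  (forall f g : 'rV[R]_n -> 'rV[R]_m, poisson_solution g f ->
    forall x : 'rV[R]_n, unit_cball x ->
      enorm (f x - ((1 - enorm x) / (1 + enorm x) ^+ n.-1)
                     *: poisson_integral f 0)
      <= sup_norm (poisson_integral f)
           * (1 - (1 - enorm x) / (1 + enorm x) ^+ n.-1)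
         + sup_norm g / (2 * n%:R) * (1 - enorm x ^+ 2))
  /\
  (forall M : R, 0 < M -> forall f g : 'rV[R]_n -> 'rV[R]_m,
    (forall x, unit_cball x -> g x = first_coord m (- (2 * n%:R * M))) ->
    (forall x, unit_cball x ->
       f x = first_coord m (M * (1 - enorm x ^+ 2))) ->
    poisson_solution g f /\
    forall x : 'rV[R]_n, unit_sphere x \/ x = 0 ->
      enorm (f x - ((1 - enorm x) / (1 + enorm x) ^+ n.-1)
                     *: poisson_integral f 0)
      = sup_norm (poisson_integral f)
           * (1 - (1 - enorm x) / (1 + enorm x) ^+ n.-1)
         + sup_norm g / (2 * n%:R) * (1 - enorm x ^+ 2)).
Proof.
case: n hn => [//|n] hn; have n0 : (0 < n)%N by case: n hn.
split=> [f g sol x x1|M M0 f g gE fE]; first exact: schwarz_inequality.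
split; first exact: paraboloid_solution gE fE.
move=> x xS; apply: (paraboloid_equality M0 gE fE) => //.
by case: xS => [xS|->]; [exact: sphere_sub_cball|rewrite /unit_cball/= enorm0].
Qed.
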